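(* For a manifold-like combinatorial cell complex (c.c.c.) $X$ with orientable and acyclic cells, with a chosen orientation $\omega_x$ on each cell $x$, the homomorphisms $$C_i(X)\to\mathbb{Z}[N(X)_i],\qquad [x]\mapsto\sum_{\gamma=\{x_0>x_1>\dots>x_i\}\in\mathcal{F}(x)}\omega_x(\gamma)\,(x_0,x_1,\dots,x_i)$$ form a chain map which induces an isomorphism $\Phi^X_*\colon H_\bullet(X)\to H_\bullet(N(X))$. Consequently, if for an order preserving map $f\colon X\to Y$ between manifold-like c.c.c.'s with orientable and acyclic cells one defines $H_i(f)=(\Phi^Y_* )^{-1}\circ H_i(N(f))\circ\Phi^X_*\colon H_i(X)\to H_i(Y)$, then each $H_i$ is a functor from the category of manifold-like c.c.c.'s with orientable and acyclic cells (with order preserving maps as morphisms) to abelian groups.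
   Context: C.c.c. A combinatorial cell complex (c.c.c.) is a finite poset $(S,\le)$ with a rank function $\mathrm{rk}\colon S\to\mathbb{Z}_{\ge 0}$; elements are called cells, $S(r)$ is the set of cells of rank $r$ ($0$-cells are vertices). A face of $x$ is a cell $y<x$ with $\mathrm{rk}(y)=\mathrm{rk}(x)-1$; then $x$ is a co-face of $y$. $\Delta x$ (resp. $\nabla x$) is the set of faces (resp. co-faces) of $x$. $\wedge$, $\vee$ denote greatest lower bound and least upper bound (considered for nonempty subsets only). Axioms: (1) $y<x$ implies $\mathrm{rk}(y)<\mathrm{rk}(x)$. (2) Every nonempty subset $T\subseteq S$ that is bounded below has a greatest lower bound $\wedge T$; and if $y<x$ there is a cell $y'$ with $\mathrm{rk}(y')=\mathrm{rk}(y)+1$ and $y<y'\le x$. (3) Each cell $x$ of rank at least one is the least upper bound of its faces, $x=\vee\Delta x$ (in particular $\Delta x\ne\emptyset$). (4) If $y<x$ and $\mathrm{rk}(x)=\mathrm{rk}(y)+2$ then $\Delta x\cap\nabla y$ consists of exactly two cells $y_+\neq y_-$, and $y_+\wedge y_-=y$. Write $\mathrm{cl}(x)=\{y\in S: y\le x\}$; down-closed subsets of $S$, with induced order and rank, are c.c.c.'s. Manifold-like. The dimension of $S$ is the maximal rank of a cell. $S$ is equidimensional of dimension $n$ if every maximal cell has rank $n$. For such $S$, the boundary is the set of cells of rank $<n$ having only one maximal cell above them. $S$ is non-singular if it is equidimensional (of dimension $n$), each $(n-1)$-cell is a face of at most two maximal cells, and each $1$-cell has exactly two vertices. $S$ is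 manifold-like if it is non-singular with empty boundary. Orientation. A flag in an equidimensional c.c.c. $S$ of dimension $n$ is a chain $x_0<x_1<\dots<x_n$ with $x_i\in S(i)$; $\mathcal{F}(S)$ is the set of flags. Two flags are adjacent if they differ in exactly one element; this makes $\mathcal{F}(S)$ a graph. $S$ is orientable if this graph is connected and bipartite. An orientation is a function $\omega\colon\mathcal{F}(S)\to\{\pm1\}$ taking opposite values on adjacent flags. A cell $x$ is orientable if $\mathrm{cl}(x)$ is; an orientation on $x$ means one on $\mathrm{cl}(x)$; $\mathcal F(x)=\mathcal F(\mathrm{cl}(x))$. Homology. Let $S$ be a c.c.c. all of whose cells are orientable, with orientation $\omega_x$ on each cell $x$ (with $\omega_v(\{v\})=1$ for vertices $v$). For $y\in\Delta x$ put $s(x,y)=\omega_x(\gamma)/\omega_y(\gamma\setminus\{x\})\in\{\pm1\}$ for any flag $\gamma=\{x>y>\cdots\}\in\mathcal{F}(x)$ (independent of $\gamma$). $C_i(S)$ is the free abelian group on symbols $[x]$, $x\in S(i)$, and $\partial[x]=\sum_{y\in\Delta x}s(x,y)[y]$. $H_i(S)$ is the homology of $(C_\bullet(S),\partial)$. $S$ is acyclic if $H_i(S)=0$ for $i>0$ and $H_0(S)\simeq\mathbb{Z}$; a cell $x$ is acyclic if $\mathrm{cl}(x)$ is. Nerve. $N(X)$ is the simplicial set with $N(X)_r=\{(x_0,\dots,x_r): x_0\ge x_1\ge\dots\ge x_r,\ x_j\in X\}$, with $j$-th face map deleting $x_j$ and degeneracies repeating an entry; $N(f)$ is the induced simplicial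 map. $H_\bullet(N(X))$ is the homology of the chain complex $\mathbb{Z}[N(X)_\bullet]$ with $\partial=\sum_j(-1)^j\partial_j$. *)

(* Defs.v *)
From HB Require Import structures.
From mathcomp Require Import all_boot all_order all_algebra.
From mathcomp Require Import zify.
From mathcomp Require Import boolp.

Set Implicit Arguments.
Unset Strict Implicit.
Unset Printing Implicit Defensive.

Import Order.TTheory GRing.Theory Num.Theory.
Local Open Scope ring_scope.

Record chain_complex := ChainComplex {
  chains :> nat -> zmodType;
  bd : forall i, {additive chains i.+1 -> chains i};
  bd_bd : forall i x, bd i (bd i.+1 x) = 0 }.

Section Homology.
Variables (C : chain_complex) (i : nat).

Definition is_cycle : {pred C i} :=
  match i return {pred C i} with
  | 0%N => fun=> true
  | j.+1 => fun x => bd C j x == 0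
  end.

Fact is_cycle_closed : zmod_closed is_cycle.
Proof.
rewrite /is_cycle; case: i => [|j]; first by split.
split=> [|x y]; rewrite !unfold_in ?raddf0 // => /eqP hx /eqP hy.
by rewrite raddfB /= hx hy subrr.
Qed.
HB.instance Definition _ := GRing.isZmodClosed.Build (C i) is_cycle is_cycle_closed.

Definition cycles := {x : C i | is_cycle x}.
HB.instance Definition _ := SubChoice.on cycles.
HB.instance Definition _ := [SubChoice_isSubZmodule of cycles by <:].

Definition is_boundary : {pred cycles} :=
  fun z => `[< exists y : C i.+1, bd C i y = val z >].

Fact is_boundary_closed : zmod_closed is_boundary.
Proof.
split=> [|x y]; first by apply/asboolP; exists 0; rewrite !raddf0.
move=> /asboolP [u hu] /asboolP [v hv].
by apply/asboolP; exists (u - v); rewrite !raddfB /= hu hv.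
Qed.
HB.instance Definition _ :=
  GRing.isZmodClosed.Build cycles is_boundary is_boundary_closed.

Definition homology : zmodType := Quotient.quot is_boundary.

End Homology.

Definition is_chain_map (C D : chain_complex)
    (f : forall i, {additive C i -> D i}) : Prop :=
  forall i x, f i (bd C i x) = bd D i (f i.+1 x).

Section HomologyMap.
Variables (C D : chain_complex) (f : forall i, {additive C i -> D i}).
Hypothesis hf : is_chain_map f.
Variable i : nat.
Local Open Scope quotient_scope.

Fact cycle_map_subproof (z : cycles C i) : is_cycle (f i (val z)).
Proof.
case: z => z /=; move: z; rewrite /is_cycle; case: i => // j z /eqP hz.
by rewrite -hf hz raddf0.
Qed.
Definition cycle_map (z : cycles C i) : cycles D i :=
  exist _ (f i (val z)) (cycle_map_subproof z).

Fact cycle_map_is_zmod_morphism : zmod_morphism cycle_map.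
Proof. by move=> x y; apply: val_inj; rewrite /= !raddfB. Qed.
HB.instance Definition _ :=
  GRing.isZmodMorphism.Build _ _ cycle_map cycle_map_is_zmod_morphism.

Definition homology_map_fun (h : homology C i) : homology D i :=
  \pi_(homology D i) (cycle_map (repr h)).

Lemma homology_map_pi (z : cycles C i) :
  homology_map_fun (\pi_(homology C i) z) = \pi_(homology D i) (cycle_map z).
Proof.
apply/eqP; rewrite /homology_map_fun -Quotient.idealrBE.
have: repr (\pi_(homology C i) z) - z \in @is_boundary C i.
  by rewrite Quotient.idealrBE reprK.
move=> /asboolP [y hy]; apply/asboolP; exists (f i.+1 y).
by rewrite -hf hy !raddfB.
Qed.

Fact homology_map_is_zmod_morphism : zmod_morphism homology_map_fun.
Proof.
move=> x y; rewrite -[x]reprK -[y]reprK -raddfB !homology_map_pi.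
by rewrite !raddfB.
Qed.
HB.instance Definition _ := GRing.isZmodMorphism.Build _ _
  homology_map_fun homology_map_is_zmod_morphism.

Definition homology_map : {additive homology C i -> homology D i} :=
  homology_map_fun.

End HomologyMap.

Definition acyclic_complex (C : chain_complex) : Prop :=
  (forall i, (0 < i)%N -> forall h : homology C i, h = 0) /\
  (exists f : {additive homology C 0 -> int}, bijective f).

Section IsoInverse.
Variables (U V : zmodType) (f : {additive U -> V}) (hf : bijective f).

Fact iso_inv_exists : exists g : V -> U, cancel f g /\ cancel g f.
Proof. by case: hf => g h1 h2; exists g. Qed.
Definition iso_inv_fun : V -> U := sval (cid iso_inv_exists).
Lemma iso_invK : cancel f iso_inv_fun /\ cancel iso_inv_fun f.
Proof. exact: svalP (cid iso_inv_exists). Qed.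
Fact iso_inv_is_zmod_morphism : zmod_morphism iso_inv_fun.
Proof.
have [fK Kf] := iso_invK.
by move=> x y; apply: (can_inj fK); rewrite raddfB /= !Kf.
Qed.
HB.instance Definition _ :=
  GRing.isZmodMorphism.Build _ _ iso_inv_fun iso_inv_is_zmod_morphism.

Definition iso_inv : {additive V -> U} := iso_inv_fun.
End IsoInverse.

Definition freeZ (T : finType) : zmodType := {ffun T -> int}.

Definition gen (T : finType) (t : T) : freeZ T := [ffun u => (u == t)%:R].

Section LinearExtension.
Variables (T : finType) (V : zmodType) (f : T -> V).

Definition lin_ext_fun (c : freeZ T) : V := \sum_t f t *~ c t.

Fact lin_ext_is_zmod_morphism : zmod_morphism lin_ext_fun.
Proof.
move=> x y; rewrite -sumrB; apply: eq_bigr => t _.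
by rewrite !ffunE mulrzBr.
Qed.
HB.instance Definition _ := GRing.isZmodMorphism.Build (freeZ T) V
  lin_ext_fun lin_ext_is_zmod_morphism.

Definition lin_ext : {additive freeZ T -> V} := lin_ext_fun.

Lemma lin_ext_gen t : lin_ext (gen t) = f t.
Proof.
rewrite /= /lin_ext_fun (bigD1 t) //= big1 ?ffunE ?eqxx ?addr0 //.
by move=> u /negPf hu; rewrite ffunE hu mulr0z.
Qed.
End LinearExtension.

Lemma freeZ_sum (T : finType) (c : freeZ T) : c = \sum_t gen t *~ c t.
Proof.
apply/ffunP => u; rewrite sum_ffunE (bigD1 u) //= big1 ?addr0.
  by rewrite ffunMzE ffunE eqxx intz.
by move=> t ht; rewrite ffunMzE ffunE eq_sym (negPf ht) mul0rz.
Qed.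

Lemma additive_freeZ0 (T : finType) (V : zmodType)
    (f : {additive freeZ T -> V}) :
  (forall t, f (gen t) = 0) -> forall c, f c = 0.
Proof.
move=> h c; rewrite (freeZ_sum c) raddf_sum big1 // => t _.
by rewrite raddfMz h mul0rz.
Qed.

Section Nerve.
Variables (d : Order.disp_t) (X : finPOrderType d).

Definition decreasing r (s : {ffun 'I_r.+1 -> X}) : bool :=
  [forall j : 'I_r.+1, forall k : 'I_r.+1, (j <= k)%N ==> (s k <= s j)%O].

(* The simplices [(s 0 >= ... >= s r)].  The degeneracies are omitted: the
   (unnormalized) chain complex only involves the face maps. *)
Definition nerve r := {s : {ffun 'I_r.+1 -> X} | decreasing s}.
HB.instance Definition _ r := Finite.on (nerve r).

Definition delete r (j : 'I_r.+2) (s : {ffun 'I_r.+2 -> X}) :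
  {ffun 'I_r.+1 -> X} := [ffun k => s (lift j k)].

Fact nerve_face_subproof r (j : 'I_r.+2) (s : nerve r.+1) :
  decreasing (delete j (val s)).
Proof.
case: s => s /= hs; apply/forallP => k; apply/forallP => l; apply/implyP => kl.
rewrite !ffunE; move/forallP/(_ (lift j k))/forallP/(_ (lift j l)): hs.
by move/implyP; apply; rewrite /= leq_bump2.
Qed.
Definition nerve_face r (j : 'I_r.+2) (s : nerve r.+1) : nerve r :=
  exist _ (delete j (val s)) (nerve_face_subproof j s).

Definition nerve_bd r : {additive freeZ (nerve r.+1) -> freeZ (nerve r)} :=
  lin_ext (fun s => \sum_(j < r.+2) gen (nerve_face j s) *~ (-1) ^+ j).

Fact bump_swap j k m : (k < j)%N -> bump k (bump j.-1 m) = bump j (bump k m).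
Proof.
case: j => // j; rewrite ltnS => kj; rewrite /bump /=.
by case: (leqP j m) => jm; case: (leqP k m) => km /=;
  rewrite ?add0n ?add1n ?ltnS; case: ltnP; case: leqP; lia.
Qed.

Definition face_swap r (p : 'I_r.+3 * 'I_r.+2) : 'I_r.+3 * 'I_r.+2 :=
  if (p.2 < p.1)%N then (inord p.2, inord p.1.-1) else (inord p.2.+1, inord p.1).

Fact face_swapK r : involutive (@face_swap r).
Proof.
move=> [j k]; have hj := ltn_ord j; have hk := ltn_ord k.
rewrite /face_swap /=; case: (ltnP k j) => h /=.
  rewrite !inordK ?ifF; try lia.
  by congr pair; apply: val_inj; rewrite /= inordK; lia.
rewrite !inordK ?ifT; try lia.
by congr pair; apply: val_inj; rewrite /= inordK; lia.
Qed.

Fact nerve_bd_bd r c : nerve_bd r (nerve_bd r.+1 c) = 0.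
Proof.
apply: (@additive_freeZ0 _ _ (nerve_bd r \o nerve_bd r.+1)) => s {c}.
rewrite /= -/(lin_ext _) lin_ext_gen raddf_sum.
pose t (p : 'I_r.+3 * 'I_r.+2) :=
  gen (nerve_face p.2 (nerve_face p.1 s)) *~ ((-1) ^+ p.2 * (-1) ^+ p.1).
transitivity (\sum_p t p).
  rewrite -(pair_bigA _ (fun j k => t (j, k))) /=; apply: eq_bigr => j _.
  rewrite raddfMz lin_ext_gen mulrz_suml.
  by apply: eq_bigr => k _; rewrite -mulrzA.
have swap p : t (face_swap p) = - t p.
  case: p => j k; have hj := ltn_ord j; have hk := ltn_ord k.
  have E1 : nerve_face (face_swap (j, k)).2 (nerve_face (face_swap (j, k)).1 s) =
            nerve_face k (nerve_face j s).
    apply: val_inj; apply/ffunP => m; rewrite !ffunE; congr (sval s _).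
    apply: val_inj; rewrite /face_swap /=; case: (ltnP k j) => h /=.
      have h1 : (k < r.+3)%N by lia.
      have h2 : (j.-1 < r.+2)%N by lia.
      by rewrite !inordK // bump_swap.
    have h1 : (j < r.+2)%N by lia.
    by rewrite !inordK // -(@bump_swap k.+1).
  have E2 : (-1) ^+ (face_swap (j, k)).2 * (-1) ^+ (face_swap (j, k)).1 =
            - ((-1) ^+ k * (-1) ^+ j) :> int.
    rewrite -!exprD /face_swap /=; case: (ltnP k j) => h /=.
      have h1 : (k < r.+3)%N by lia.
      have h2 : (j.-1 < r.+2)%N by lia.
      rewrite !inordK // -[in RHS](prednK (leq_ltn_trans (leq0n _) h)).
      by rewrite addnS exprS mulN1r opprK addnC.
    have h1 : (j < r.+2)%N by lia.
    by rewrite !inordK // addnS exprS mulN1r addnC.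
  by rewrite /t E1 E2 mulrNz.
have: \sum_p t p = - \sum_p t p.
  rewrite [LHS](reindex_inj (inv_inj (@face_swapK r))) /= -sumrN.
  by apply: eq_bigr => p _; rewrite swap.
move: (\sum_p t p) => c h; apply/ffunP => u; move/ffunP/(_ u): h.
by rewrite !ffunE; move: (c u) => z; lia.
Qed.

Definition nerve_complex : chain_complex :=
  ChainComplex nerve_bd_bd.

End Nerve.

Section NerveMap.
Variables (d d' : Order.disp_t) (X : finPOrderType d) (Y : finPOrderType d').
Variable f : {omorphism X -> Y}.

Fact nerve_map_subproof r (s : nerve X r) :
  decreasing [ffun k => f (val s k)].
Proof.
case: s => s /= hs; apply/forallP => k; apply/forallP => l; apply/implyP => kl.
rewrite !ffunE; apply: omorph_le.
by move/forallP/(_ k)/forallP/(_ l)/implyP: hs; apply.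
Qed.
Definition nerve_map r (s : nerve X r) : nerve Y r :=
  exist _ [ffun k => f (val s k)] (nerve_map_subproof s).

Definition nerve_chain_map r : {additive nerve_complex X r -> nerve_complex Y r} :=
  lin_ext (fun s => gen (nerve_map s)).

Fact nerve_chain_mapP : is_chain_map nerve_chain_map.
Proof.
move=> r c; apply/eqP; rewrite -subr_eq0; apply/eqP; move: c.
apply: (@additive_freeZ0 _ _
  ((nerve_chain_map r \o nerve_bd X r) \- (nerve_bd Y r \o nerve_chain_map r.+1))).
move=> s /=; rewrite -!/(lin_ext _) !lin_ext_gen raddf_sum -sumrB big1 // => j _.
rewrite raddfMz lin_ext_gen (_ : nerve_map _ = nerve_face j (nerve_map s)) ?subrr //.
by apply: val_inj; apply/ffunP => k; rewrite /= !ffunE.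
Qed.

Definition nerve_homology i :
    {additive homology (nerve_complex X) i -> homology (nerve_complex Y) i} :=
  homology_map nerve_chain_mapP i.

End NerveMap.

Section Bounds.
Variables (d : Order.disp_t) (S : finPOrderType d).
Implicit Types (T : {set S}) (g x : S).

Definition is_glb T g : Prop :=
  (forall t, t \in T -> (g <= t)%O) /\
  (forall l, (forall t, t \in T -> (l <= t)%O) -> (l <= g)%O).

Definition is_lub T g : Prop :=
  (forall t, t \in T -> (t <= g)%O) /\
  (forall u, (forall t, t \in T -> (t <= u)%O) -> (g <= u)%O).

Definition faces_for (rk : S -> nat) x : {set S} :=
  [set y | (y < x)%O && (rk x == (rk y).+1)].

Definition cofaces_for (rk : S -> nat) y : {set S} :=
  [set x | y \in faces_for rk x].

End Bounds.

(* [faces_neq0]: joins are only considered for nonempty sets, so [x] being the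
   join of its faces includes that it has at least one. *)
HB.mixin Record FinPOrder_isCCC d S of Order.FinPOrder d S := {
  rk : S -> nat;
  rk_lt : forall x y : S, (y < x)%O -> (rk y < rk x)%N;
  glb_exists : forall T : {set S}, T != set0 ->
    (exists l, forall t, t \in T -> (l <= t)%O) -> exists g, is_glb T g;
  step_up : forall x y : S, (y < x)%O ->
    exists y', [/\ rk y' = (rk y).+1, (y < y')%O & (y' <= x)%O];
  faces_neq0 : forall x : S, (0 < rk x)%N -> faces_for rk x != set0;
  faces_lub : forall x : S, (0 < rk x)%N -> is_lub (faces_for rk x) x;
  diamond : forall x y : S, (y < x)%O -> rk x = (rk y).+2 ->
    exists yp ym, [/\ yp != ym,
      faces_for rk x :&: cofaces_for rk y = [set yp; ym] &
      is_glb [set yp; ym] y] }.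

#[short(type="cccType")]
HB.structure Definition CCC d := {S of FinPOrder_isCCC d S & Order.FinPOrder d S}.

Arguments rk_lt {d s} [x y].
Arguments step_up {d s} [x y].
Arguments faces_neq0 {d s} [x].
Arguments faces_lub {d s} [x].
Arguments diamond {d s} [x y].

Section Cells.
Variables (d : Order.disp_t) (S : cccType d).
Implicit Types (A F G : {set S}) (x y : S).

Definition faces x : {set S} := faces_for rk x.

(* A down-closed subset of [S], with the induced order and rank, is again a
   c.c.c.; such c.c.c.'s, in particular [S] itself and the closures of cells,
   are represented by subsets [A : {set S}] of the ambient [S]. *)
Definition down_closed A : Prop :=
  forall x y, x \in A -> (y <= x)%O -> y \in A.

Definition cl x : {set S} := [set y | (y <= x)%O].

Lemma cl_down x : down_closed (cl x).
Proof. by move=> y z; rewrite !inE => yx zy; apply: le_trans zy yx. Qed.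

Lemma setT_down : down_closed [set: S].
Proof. by move=> x y _ _; rewrite inE. Qed.

Definition dim A : nat := \max_(x in A) rk x.

Definition maximal_cells A : {set S} :=
  [set x in A | [forall y in A, ~~ (x < y)%O]].

Definition equidimensional A : Prop :=
  forall x, x \in maximal_cells A -> rk x = dim A.

Definition boundary A : {set S} :=
  [set x in A | (rk x < dim A)%N &&
                (#|[set m in maximal_cells A | (x <= m)%O]| == 1%N)].

Definition non_singular A : Prop :=
  [/\ equidimensional A,
      forall y, y \in A -> (rk y).+1 = dim A ->
        (#|[set m in maximal_cells A | y \in faces m]| <= 2)%N &
      forall x, x \in A -> rk x = 1%N -> #|faces x| = 2%N].

Definition manifold_like A : Prop := non_singular A /\ boundary A = set0.

(* A flag [x_0 < ... < x_n] is represented by the set [{x_0, ..., x_n}]. *)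
Definition flags A : {set {set S}} :=
  [set F : {set S} | [&& F \subset A,
    [forall x in F, forall y in F, (x >=< y)%O] &
    [forall r : 'I_(dim A).+1, #|[set x in F | rk x == r]| == 1%N]]].

Definition adjacent A F G : bool :=
  [&& F \in flags A, G \in flags A, #|F :\: G| == 1%N & #|G :\: F| == 1%N].

Definition orientable A : Prop :=
  {in flags A &, forall F G, connect (adjacent A) F G} /\
  (exists c : {set S} -> bool, forall F G, adjacent A F G -> c F != c G).

Definition is_orientation A (w : {set S} -> int) : Prop :=
  (forall F, F \in flags A -> w F = 1 \/ w F = -1) /\
  (forall F G, adjacent A F G -> w F = - w G).

End Cells.

Record oriented_cells d (S : cccType d) := OrientedCells {
  orientation :> S -> {set S} -> int;
  oriented_orientable : forall x : S, orientable (cl x);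
  orientationP : forall x : S, is_orientation (cl x) (orientation x);
  orientation_vertex : forall v : S, rk v = 0%N -> orientation v [set v] = 1 }.

Section FlagTheory.
Variables (d : Order.disp_t) (S : cccType d).
Implicit Types (F G : {set S}) (x y z : S).

Lemma rk_le x y : (y <= x)%O -> (rk y <= rk x)%N.
Proof. by rewrite le_eqVlt => /orP [/eqP -> //|/rk_lt /ltnW]. Qed.

Lemma dim_cl x : dim (cl x) = rk x.
Proof.
apply/eqP; rewrite eqn_leq; apply/andP; split.
  by apply/bigmax_leqP => y; rewrite inE => /rk_le.
by apply: (leq_bigmax_cond (F := @rk _ S)); rewrite inE.
Qed.

Lemma flagP x F : reflect
  [/\ forall y, y \in F -> (y <= x)%O,
      forall y z, y \in F -> z \in F -> (y >=< z)%O &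
      forall r, (r <= rk x)%N -> exists2 y, y \in F & rk y = r]
  (F \in flags (cl x)).
Proof.
rewrite inE dim_cl; apply: (iffP and3P) => [[/subsetP h1 h2 h3]|[h1 h2 h3]].
  split.
  - by move=> y /h1; rewrite inE.
  - by move=> y z yF zF; move/forall_inP: h2 => /(_ y yF) /forall_inP /(_ z zF).
  move=> r; rewrite -ltnS => rx; move/forallP/(_ (Ordinal rx)): h3.
  move=> /cards1P [y /setP /(_ y)]; rewrite !inE eqxx => /andP [yF /eqP yr].
  by exists y.
split.
- by apply/subsetP => y /h1; rewrite inE.
- by apply/forall_inP => y yF; apply/forall_inP => z zF; apply: h2.
apply/forallP => r; have [y yF yr] := h3 r (ltn_ord r).
apply/cards1P; exists y; apply/setP => z; rewrite !inE.
apply/andP/eqP => [[zF /eqP zr]|->]; last by rewrite yF yr.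
have := h2 _ _ yF zF; rewrite /Order.comparable !le_eqVlt.
case/orP => /orP [/eqP -> //|/rk_lt]; rewrite ?yr ?zr ?ltnn //.
Qed.

Lemma flag_uniq x F y z :
  F \in flags (cl x) -> y \in F -> z \in F -> rk y = rk z -> y = z.
Proof.
move=> /flagP [_ h _] yF zF e; have := h _ _ yF zF.
rewrite /Order.comparable !le_eqVlt.
by case/orP => /orP [/eqP -> //|/rk_lt]; rewrite e ltnn.
Qed.

Lemma flag_top x F : F \in flags (cl x) -> x \in F.
Proof.
move=> /flagP [h1 _ h3]; have [y yF e] := h3 _ (leqnn _).
by have := h1 _ yF; rewrite le_eqVlt => /orP [/eqP <- //|/rk_lt]; rewrite e ltnn.
Qed.

Lemma facesP x y : reflect ((y < x)%O /\ rk x = (rk y).+1) (y \in faces x).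
Proof. by rewrite inE; apply: (iffP andP) => [[? /eqP]|[? ->]]. Qed.

Lemma notin_flag x y G : y \in faces x -> G \in flags (cl y) -> x \notin G.
Proof.
move=> /facesP [yx _] /flagP [h _ _]; apply/negP => /h xy.
by have := le_lt_trans xy yx; rewrite ltxx.
Qed.

Lemma flag_cons x y G :
  y \in faces x -> G \in flags (cl y) -> x |: G \in flags (cl x).
Proof.
move=> /facesP [yx rx] /flagP [h1 h2 h3].
have h1' u : u \in G -> (u <= x)%O by move=> /h1 uy; apply: le_trans uy (ltW yx).
apply/flagP; split.
- by move=> u /setU1P [->//|/h1'].
- move=> u v /setU1P [->|uG] /setU1P [->|vG]; rewrite ?comparablexx //.
  + by rewrite /Order.comparable h1' ?orbT.
  + by rewrite /Order.comparable h1'.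
  exact: h2.
move=> r; rewrite leq_eqVlt => /orP [/eqP ->|].
  by exists x => //; rewrite setU11.
by rewrite rx ltnS => /h3 [u uG e]; exists u => //; rewrite setU1r.
Qed.

Lemma flag_behead x y F : y \in faces x -> F \in flags (cl x) -> y \in F ->
  F :\ x \in flags (cl y).
Proof.
move=> /facesP [yx rx] hF yF; have /flagP [h1 h2 h3] := hF.
apply/flagP; split.
- move=> u /setD1P [ux uF].
  have /rk_lt : (u < x)%O by rewrite lt_neqAle ux h1.
  rewrite rx ltnS => uy; have := h2 _ _ uF yF; rewrite /Order.comparable.
  by case/orP => //; rewrite le_eqVlt => /orP [/eqP <- //|/rk_lt]; lia.
- by move=> u v /setD1P [_ uF] /setD1P [_ vF]; apply: h2.
move=> r ry; have [u uF e] := h3 r (leq_trans ry (ltnW (rk_lt yx))).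
exists u => //; apply/setD1P; split=> //; apply/eqP => ux.
by move: ry; rewrite -e ux rx ltnn.
Qed.

Lemma flag_exists x : exists F, F \in flags (cl x).
Proof.
move: {2}(rk x) (leqnn (rk x)) => n; elim: n x => [|n IH] x.
  rewrite leqn0 => /eqP e; exists [set x]; apply/flagP; split.
  - by move=> y /set1P ->.
  - by move=> y z /set1P -> /set1P ->; rewrite comparablexx.
  by rewrite e => r; rewrite leqn0 => /eqP ->; exists x; rewrite ?inE.
rewrite leq_eqVlt => /orP [/eqP e|]; last by rewrite ltnS => /IH.
have : (0 < rk x)%N by rewrite e.
move=> /faces_neq0 /set0Pn [y hy]; have /facesP [_ ry] : y \in faces x by [].
have [|F hF] := IH y; first by lia.
by exists (x |: F); apply: flag_cons hy hF.
Qed.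

Lemma cardsDU1 x F G : x \notin F -> x \notin G ->
  (x |: F) :\: (x |: G) = F :\: G.
Proof.
move=> xF _; apply/setP => u; rewrite !inE.
by case: eqP => [->|_] //=; rewrite (negPf xF) andbF.
Qed.

Lemma adjacent_cons x y F G : y \in faces x ->
  adjacent (cl y) F G -> adjacent (cl x) (x |: F) (x |: G).
Proof.
move=> yx /and4P [hF hG c1 c2]; have xF := notin_flag yx hF.
have xG := notin_flag yx hG.
by apply/and4P; split; rewrite ?cardsDU1 ?flag_cons //; apply: flag_cons yx _.
Qed.

Lemma adjacent_diamond x y y' z G : y \in faces x -> y' \in faces x ->
  z \in faces y -> z \in faces y' -> y != y' -> G \in flags (cl z) ->
  adjacent (cl x) (x |: (y |: G)) (x |: (y' |: G)).
Proof.
move=> yx y'x zy zy' ne hG.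
have hF := flag_cons yx (flag_cons zy hG).
have hF' := flag_cons y'x (flag_cons zy' hG).
have aux u u' : u \in faces x -> z \in faces u -> u != u' ->
    #|(x |: (u |: G)) :\: (x |: (u' |: G))| == 1%N.
  move=> ux zu uu'; apply/cards1P; exists u; apply/setP => v; rewrite !inE.
  case: (eqVneq v x) => [->|vx] /=.
    by apply/esym/eqP => e; have /facesP [] := ux; rewrite e ltxx.
  case: (eqVneq v u) => [->|vu] /=; first by rewrite (negPf uu') (negPf (notin_flag zu hG)).
  by case: (v \in G); rewrite ?orbT ?andbF.
by apply/and4P; split=> //; apply: aux; rewrite // eq_sym.
Qed.

End FlagTheory.

Section Cellular.
Variables (d : Order.disp_t) (S : cccType d) (om : oriented_cells S).
Implicit Types (F G : {set S}) (x y z : S).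

(* [s(x,y)], computed from some flag of [cl x] through [y]; [incidenceE] below
   shows that the choice of the flag is irrelevant. *)
Definition incidence x y : int :=
  if [pick F in flags (cl x) | y \in F] is Some F
  then om x F / om y (F :\ x) else 0.

Lemma orient_sign x F : F \in flags (cl x) -> om x F = 1 \/ om x F = -1.
Proof. exact: (orientationP om x).1. Qed.

Lemma incidenceE x y F : y \in faces x -> F \in flags (cl x) -> y \in F ->
  incidence x y = om x F / om y (F :\ x).
Proof.
move=> yx hF yF; rewrite /incidence; case: pickP => [F0 /andP [h0 y0]|]; last first.
  by move/(_ F); rewrite hF yF.
have hG := flag_behead yx hF yF; have hG0 := flag_behead yx h0 y0.
rewrite -(setD1K (flag_top hF)) -(setD1K (flag_top h0)).
move: (F0 :\ x) (F :\ x) hG0 hG => G0 G hG0 hG.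
rewrite !setU1K ?(notin_flag yx) // {F F0 hF yF h0 y0}.
have /connectP [p] := (oriented_orientable om y).1 _ _ hG0 hG.
elim: p G0 hG0 => [|G1 p IH] G0 hG0 /=; first by move=> _ ->.
move=> /andP [a01 hp] e.
have hG1 : G1 \in flags (cl y) by case/and4P: a01.
rewrite -(IH _ hG1 hp e) ((orientationP om x).2 _ _ (adjacent_cons yx a01)).
rewrite ((orientationP om y).2 _ _ a01).
by case: (orient_sign hG1) => ->; rewrite ?opprK ?invrN ?invr1 ?mulrN ?mulr1 ?opprK.
Qed.

Lemma incidence_cons x y G : y \in faces x -> G \in flags (cl y) ->
  incidence x y = om x (x |: G) / om y G.
Proof.
move=> yx hG; rewrite (incidenceE yx (flag_cons yx hG)).
  by rewrite setU1K // (notin_flag yx hG).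
by rewrite setU1r // flag_top.
Qed.

Lemma incidence_diamond x y y' z : y \in faces x -> y' \in faces x ->
  z \in faces y -> z \in faces y' -> y != y' ->
  incidence x y * incidence y z + incidence x y' * incidence y' z = 0.
Proof.
move=> yx y'x zy zy' ne; have [G hG] := flag_exists z.
rewrite (incidence_cons zy hG) (incidence_cons zy' hG).
rewrite (incidence_cons yx (flag_cons zy hG)).
rewrite (incidence_cons y'x (flag_cons zy' hG)).
rewrite ((orientationP om x).2 _ _ (adjacent_diamond yx y'x zy zy' ne hG)).
by case: (orient_sign (flag_cons zy hG)) => ->;
   case: (orient_sign (flag_cons zy' hG)) => ->;
   case: (orient_sign hG) => ->;
   case: (orient_sign (flag_cons y'x (flag_cons zy' hG))) => ->.
Qed.

Variables (A : {set S}) (hA : down_closed A).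

Definition cells r := {x : S | (x \in A) && (rk x == r)}.
HB.instance Definition _ r := Finite.on (cells r).

Definition cell_bd r : {additive freeZ (cells r.+1) -> freeZ (cells r)} :=
  lin_ext (fun e => \sum_(f : cells r | val f \in faces (val e))
                      gen f *~ incidence (val e) (val f)).

Fact cell_bd_bd r c : cell_bd r (cell_bd r.+1 c) = 0.
Proof.
apply: (@additive_freeZ0 _ _ (cell_bd r \o cell_bd r.+1)) => x {c}.
rewrite /= -/(lin_ext _) lin_ext_gen raddf_sum.
apply/ffunP => z; rewrite sum_ffunE [RHS]ffunE.
transitivity (\sum_(y : cells r.+1 | (val y \in faces (val x)) &&
                                     (val z \in faces (val y)))
               incidence (val x) (val y) * incidence (val y) (val z)).
  rewrite big_mkcondr /=; apply: eq_bigr => y yx.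
  rewrite raddfMz lin_ext_gen ffunMzE sum_ffunE big_mkcond (bigD1 z) //= big1.
    rewrite addr0; case: ifP => _; last by rewrite mul0rz.
    by rewrite ffunMzE ffunE eqxx intz -mulrzr intz mulrC.
  by move=> u /negPf uz; case: ifP; rewrite // ffunMzE ffunE eq_sym uz mul0rz.
case: (boolP [exists y : cells r.+1, (val y \in faces (val x)) &&
                (val z \in faces (val y))]) => [|/existsPn h]; last first.
  by apply: big_pred0 => y; apply: negPf.
move=> /existsP [y0 /andP [/facesP [y0x rx] /facesP [zy0 ry0]]].
have zx := lt_trans zy0 y0x; have rxz : rk (val x) = (rk (val z)).+2 by rewrite rx ry0.
have /andP [xA _] := valP x; have /andP [_ /eqP rz] := valP z.
have [yp [ym [ne E _]]] := diamond zx rxz.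
have {}E y : (y \in faces (val x)) && (val z \in faces y) = (y == yp) || (y == ym).
  by move/setP/(_ y): E; rewrite !in_setI !inE.
have /andP [ypx zyp] : (yp \in faces (val x)) && (val z \in faces yp).
  by rewrite E eqxx.
have /andP [ymx zym] : (ym \in faces (val x)) && (val z \in faces ym).
  by rewrite E eqxx orbT.
have inA y : y \in faces (val x) -> val z \in faces y -> (y \in A) && (rk y == r.+1).
  move=> /facesP [yx _] /facesP [_ ->].
  by rewrite (hA xA (ltW yx)) rz eqxx.
pose Yp : cells r.+1 := exist _ yp (inA _ ypx zyp).
pose Ym : cells r.+1 := exist _ ym (inA _ ymx zym).
under eq_bigl => y do rewrite E.
rewrite (bigD1 Yp) /= ?eqxx // (bigD1 Ym) /=; last first.
  by rewrite eqxx orbT -val_eqE /= eq_sym.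
rewrite big1 ?addr0; last first.
  by move=> y; rewrite -!val_eqE /=; case: eqP => //= _; case: eqP.
exact: incidence_diamond.
Qed.

Definition cellular : chain_complex := ChainComplex cell_bd_bd.

End Cellular.

Definition cellular_full d (S : cccType d) (om : oriented_cells S) :
  chain_complex := cellular om (@setT_down d S).

(* The flag graph of each cell being connected, its orientations are unique up
   to sign: the homology groups computed from two orientations are isomorphic,
   so that being acyclic does not depend on [om]. *)
Definition acyclic d (S : cccType d) (A : {set S}) (hA : down_closed A) : Prop :=
  exists om : oriented_cells S, acyclic_complex (cellular om hA).

Section Comparison.
Variables (d : Order.disp_t) (X : cccType d) (om : oriented_cells X).

Definition simplex_set r (s : nerve X r) : {set X} :=
  [set val s j | j : 'I_r.+1].

(* The flags [{x_0 > ... > x_i}] of [cl x] are in bijection, via [simplex_set],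
   with the [i]-simplices [(x_0, ..., x_i)] of the nerve whose underlying set is
   such a flag. *)
Definition Phi i :
    {additive cellular_full om i -> nerve_complex X i} :=
  lin_ext (fun x => \sum_(s : nerve X i | simplex_set s \in flags (cl (val x)))
                      gen s *~ om (val x) (simplex_set s)).

End Comparison.

Record category := Category {
  obj :> Type;
  hom : obj -> obj -> Type;
  idm : forall a, hom a a;
  compose : forall a b c, hom b c -> hom a b -> hom a c;
  compose_idl : forall a b (f : hom a b), compose (idm b) f = f;
  compose_idr : forall a b (f : hom a b), compose f (idm a) = f;
  composeA : forall a b c e (h : hom c e) (g : hom b c) (f : hom a b),
    compose h (compose g f) = compose (compose h g) f }.

Definition is_functor (C D : category) (F0 : C -> D)
    (F1 : forall a b : C, hom a b -> hom (F0 a) (F0 b)) : Prop :=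
  (forall a : C, F1 a a (idm a) = idm (F0 a)) /\
  (forall (a b c : C) (g : hom b c) (f : hom a b),
     F1 a c (compose g f) = compose (F1 b c g) (F1 a b f)).

Lemma additive_ext (U V : zmodType) (f g : {additive U -> V}) : f =1 g -> f = g.
Proof.
case: f g => [f [[hf]]] [g [[hg]]] /= /funext fg; subst g.
by rewrite (Prop_irrelevance hf hg).
Qed.

Definition ab_category : category :=
  @Category zmodType (fun U V => {additive U -> V})
    (fun U => idfun) (fun U V W g f => g \o f)
    (fun U V f => @additive_ext U V (idfun \o f) f (frefl f))
    (fun U V f => @additive_ext U V (f \o idfun) f (frefl f))
    (fun U V W Z h g f =>
       @additive_ext U Z (h \o (g \o f)) ((h \o g) \o f) (frefl _)).

Lemma omorphism_ext d d' (X : porderType d) (Y : porderType d')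
    (f g : {omorphism X -> Y}) : f =1 g -> f = g.
Proof.
case: f g => [f [[hf]]] [g [[hg]]] /= /funext fg; subst g.
by rewrite (Prop_irrelevance hf hg).
Qed.

Record mccc := Mccc {
  mccc_disp : Order.disp_t;
  mccc_sort :> cccType mccc_disp;
  mccc_manifold : manifold_like [set: mccc_sort];
  mccc_orientable : forall x : mccc_sort, orientable (cl x);
  mccc_acyclic : forall x : mccc_sort, acyclic (@cl_down _ mccc_sort x) }.

Definition mccc_category : category :=
  @Category mccc (fun X Y => {omorphism X -> Y})
    (fun X => idfun) (fun X Y Z g f => g \o f)
    (fun X Y f => @omorphism_ext _ _ X Y (idfun \o f) f (frefl f))
    (fun X Y f => @omorphism_ext _ _ X Y (f \o idfun) f (frefl f))
    (fun X Y Z W h g f =>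
       @omorphism_ext _ _ X W (h \o (g \o f)) ((h \o g) \o f) (frefl _)).

(* Main.v *)
Require Import Defs.
From mathcomp Require Import all_boot all_order all_algebra.
From HB Require Import structures.
From mathcomp Require Import zify ring.
From mathcomp Require Import boolp.

(** A cell complex is glued from the closures of its cells, and so is its nerve,
    so that it suffices to compare the two homologies below a single cell.

    The map [Phi] commutes with boundaries because deleting the top cell of a
    flag of [x] produces the flags of the faces of [x], with the incidence
    numbers as signs ([flag_face0_sum]), while deleting any other entry produces
    each simplex from two adjacent flags, which cancel ([flag_face_sum0]).  There
    are exactly two by the diamond axiom, or, for the last entry, because an edge
    has two vertices.

    For the isomorphism, consider the mapping cone of [Phi] and, for each
    down-closed set [A], its elements supported on [A].  Exactness of the cone on
    [A] is proved by induction on the size of [A] ([cone_exact]): if [x] is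
    maximal in [A], then [A] is the union of [A :\ x] and [cl x], and exactness
    on both and on their intersection gives exactness on [A]
    ([mayer_vietoris]).  There remains [A = cl x] ([cl_exact]), where the nerve is
    contractible, being a cone with apex [x] ([contraction_bd]), and the cellular
    complex is acyclic by hypothesis.  That hypothesis concerns some orientation
    of the cells; two orientations differ by a sign on each cell, and rescaling
    by these signs is an isomorphism of complexes ([cell_emb_bd]).  It also gives
    H_0 as isomorphic to the integers in an unspecified way, which is enough to
    conclude that the augmentation detects boundaries ([acyclic0_boundary]).

    Exactness of the whole cone says that [Phi] induces isomorphisms
    ([cone_exact_iso]).  Functoriality is then formal: the homology of the nerve
    is a functor, and the inverse isomorphisms cancel. *)

Set Implicit Arguments.
Unset Strict Implicit.
Unset Printing Implicit Defensive.

Import Order.TTheory GRing.Theory Num.Theory.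
Local Open Scope ring_scope.

(** * Exactness, mapping cones and Mayer-Vietoris *)

(** Stated on elements of the ambient complex satisfying a predicate, so that
    subcomplexes never have to be built as complexes of their own.  Every
    degree-0 element counts as a cycle: in degree 0 this asks that [P 0]
    consists of boundaries. *)
Definition exact_on (K : chain_complex) (P : forall i, K i -> Prop) : Prop :=
  forall i (z : K i), P i z -> is_cycle z ->
    exists2 w : K i.+1, P i.+1 w & bd K i w = z.

Definition subcomplex (K : chain_complex) (P : forall i, K i -> Prop) : Prop :=
  [/\ forall i (x y : K i), P i x -> P i y -> P i (x + y),
      forall i (x : K i), P i x -> P i (- x) &
      forall i (x : K i.+1), P i.+1 x -> P i (bd K i x)].

Lemma bd_cycle (K : chain_complex) i (x : K i.+1) : is_cycle (bd K i x).
Proof. by case: i x => //= i x; rewrite bd_bd. Qed.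

(** Write a cycle of [P + Q] as [a + b].  Then [bd a = - bd b] is a cycle of
    [R], the intersection of [P] and [Q], so it bounds some [w] in [R], and
    [a - w] and [b + w] are cycles of [P] and of [Q]; both are boundaries. *)
Lemma mayer_vietoris (K : chain_complex) (P Q R U : forall i, K i -> Prop) :
  subcomplex P -> subcomplex Q ->
  (forall i (x : K i), R i x <-> P i x /\ Q i x) ->
  (forall i (z : K i), U i z <-> exists a b, [/\ P i a, Q i b & z = a + b]) ->
  exact_on P -> exact_on Q -> exact_on R -> exact_on U.
Proof.
move=> [PD PN Pbd] [QD QN Qbd] RE UE exP exQ exR i z /UE [a [b [Pa Qb ->]]] zc.
suff [w [Pw Qw ca cb]] : exists w : K i,
    [/\ P i (a - w), Q i (b + w), is_cycle (a - w) & is_cycle (b + w)].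
  have [u Pu hu] := exP _ _ Pw ca; have [v Qv hv] := exQ _ _ Qw cb.
  exists (u + v); first by apply/UE; exists u, v.
  by rewrite raddfD /= hu hv addrACA addNr addr0.
case: i z a b Pa Qb zc => [|i] z a b Pa Qb /= zc.
  (* In degree 0 the summands [a] and [b] are already cycles: take [w = 0]. *)
  by exists 0; rewrite subr0 addr0; split.
have ab : bd K i b = - bd K i a.
  by apply/eqP; rewrite -addr_eq0 addrC -raddfD.
have [|w /RE [Pw Qw] hw] := exR i (bd K i a) _ (bd_cycle a).
  by apply/RE; split; [apply: Pbd | rewrite -[bd _ _ _]opprK -ab; apply/QN/Qbd].
exists w; split; rewrite ?raddfB ?raddfD /= ?hw ?ab ?subrr ?addNr //.
  by apply: PD => //; apply: PN.
exact: QD.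
Qed.

Section HomologyClasses.
Local Open Scope quotient_scope.

Lemma pi_eq0 (K : chain_complex) i (z : cycles K i) :
  (\pi_(homology K i) z == 0) = (z \in @is_boundary K i).
Proof.
have <- : \pi_(homology K i) 0 = 0 by rewrite raddf0.
by rewrite -Quotient.idealrBE subr0.
Qed.

Lemma homology0_boundary (K : chain_complex) i (c : K i) :
  (forall h : homology K i, h = 0) -> is_cycle c ->
  exists y : K i.+1, bd K i y = c.
Proof.
move=> h0 cc; have /eqP := h0 (\pi_(homology K i) (exist _ c cc : cycles K i)).
by rewrite pi_eq0 => /asboolP.
Qed.

Lemma inj_surj_bij (U V : Type) (g : U -> V) :
  injective g -> (forall v, exists u, g u = v) -> bijective g.
Proof.
move=> gI gS; pose h v := sval (cid (gS v)).
have gK : cancel h g by move=> v; apply: (svalP (cid (gS v))).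
by exists h => // u; apply: gI; rewrite gK.
Qed.

End HomologyClasses.

Section MappingCone.
Variables (C D : chain_complex) (f : forall i, {additive C i -> D i}).
Hypothesis hf : is_chain_map f.

(** The cone is shifted so that [D 0] sits in degree 0 and [C 0] in degree 1. *)
Definition cone_chains (i : nat) : zmodType :=
  match i with 0 => D 0 | j.+1 => (C j * D j.+1)%type end.

Definition cone_bd_fun i : cone_chains i.+1 -> cone_chains i :=
  match i return cone_chains i.+1 -> cone_chains i with
  | 0 => fun p => f 0 p.1 - bd D 0 p.2
  | j.+1 => fun p => (bd C j p.1, f j.+1 p.1 - bd D j.+1 p.2)
  end.

Fact cone_bd_is_zmod_morphism i : zmod_morphism (@cone_bd_fun i).
Proof.
have aux j (p q : C j * D j.+1) : f j (p - q).1 - bd D j (p - q).2 =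
    (f j p.1 - bd D j p.2) - (f j q.1 - bd D j q.2).
  by rewrite !raddfB /= !opprK addrACA.
case: i => [|j] p q; first exact: aux.
by rewrite /cone_bd_fun aux raddfB.
Qed.
HB.instance Definition _ i := GRing.isZmodMorphism.Build
  (cone_chains i.+1) (cone_chains i) (@cone_bd_fun i)
  (@cone_bd_is_zmod_morphism i).

Fact cone_bd_bd i (x : cone_chains i.+2) :
  cone_bd_fun (cone_bd_fun x) = 0.
Proof.
have aux j (p : C j.+1 * D j.+2) :
    f j (bd C j p.1) - bd D j (f j.+1 p.1 - bd D j.+1 p.2) = 0.
  by rewrite raddfB /= bd_bd subr0 hf subrr.
by case: i x => [|i] x; rewrite /cone_bd_fun /= aux ?bd_bd.
Qed.

Definition mapping_cone : chain_complex :=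
  @ChainComplex cone_chains (fun i => @cone_bd_fun i) cone_bd_bd.

Local Open Scope quotient_scope.

(** A cycle [z] of [C] with [f z = bd y] gives the cycle [(z, y)] of the cone,
    whose primitive exhibits [z] as a boundary; a cycle [z] of [D] gives the
    cycle [(0, z)], whose primitive [(c, n)] says that [z] is homologous to the
    image of the cycle [c]. *)
Lemma cone_exact_iso : exact_on (fun i (_ : mapping_cone i) => True) ->
  forall i, bijective (homology_map hf i).
Proof.
move=> ex i; apply: inj_surj_bij.
  apply: raddf_inj => h; rewrite -[h]reprK; move: (repr h) => z {h}.
  rewrite /= homology_map_pi => /eqP; rewrite pi_eq0 => /asboolP [y hy].
  have [||[c n] _ e] := ex i.+1 ((val z, y) : C i * D i.+1) => //.
    case: i z y hy {ex} => [|i] z y /= hy; first by rewrite hy subrr.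
    by rewrite /is_cycle /cone_bd_fun /= hy subrr (eqP (valP z)).
  by apply/eqP; rewrite pi_eq0; apply/asboolP; exists c; case: e.
move=> h; rewrite -[h]reprK; move: (repr h) => z {h}.
have [c [n [cc e]]] : exists (c : C i) (n : D i.+1),
    is_cycle c /\ f i c - bd D i n = val z.
  case: i z => [|i] z.
    by have [||[c n] _ e] := ex 0 (val z : D 0) => //; exists c, n.
  have [||[c n] _ [e1 e2]] := ex i.+1 ((0, val z) : C i * D i.+1) => //.
    move: (valP z); case: i z => [|i] z; rewrite /is_cycle /= => /eqP bz.
      by rewrite raddf0 bz subrr.
    by rewrite /cone_bd_fun /= !raddf0 bz subrr.
  by exists c, n; split=> //; apply/eqP.
exists (\pi_(homology C i) (exist _ c cc : cycles C i)).
rewrite /= homology_map_pi; apply/eqP; rewrite -Quotient.idealrBE.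
by apply/asboolP; exists n; rewrite raddfB /= -e opprB addrC subrK.
Qed.

End MappingCone.

(** * Supports in free abelian groups *)

Section Support.
Implicit Types T U : finType.

Definition supported T (P : pred T) (c : freeZ T) : Prop :=
  forall t, ~~ P t -> c t = 0.

Lemma supportedD T (P : pred T) c c' :
  supported P c -> supported P c' -> supported P (c + c').
Proof. by move=> h h' t Pt; rewrite ffunE h ?h' ?addr0. Qed.

Lemma supportedN T (P : pred T) c : supported P c -> supported P (- c).
Proof. by move=> h t Pt; rewrite ffunE h ?oppr0. Qed.

Lemma supported0 T (P : pred T) : supported P 0.
Proof. by move=> t _; rewrite ffunE. Qed.

Lemma supportedMz T (P : pred T) c n : supported P c -> supported P (c *~ n).
Proof. by move=> h t Pt; rewrite ffunMzE h ?mul0rz. Qed.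

Lemma supported_gen T (P : pred T) t : P t -> supported P (gen t).
Proof. by move=> Pt u Pu; rewrite ffunE; case: eqP Pu => // ->; rewrite Pt. Qed.

Lemma supported_sum T I (r : seq I) (B : pred I) (F : I -> freeZ T) (P : pred T) :
  (forall i, B i -> supported P (F i)) -> supported P (\sum_(i <- r | B i) F i).
Proof.
move=> h; apply: big_ind => //; first exact: supported0.
exact: supportedD.
Qed.

Lemma supported_map T U (P : pred T) (Q : pred U)
    (f : {additive freeZ T -> freeZ U}) :
  (forall t, P t -> supported Q (f (gen t))) ->
  forall c, supported P c -> supported Q (f c).
Proof.
move=> h c Pc; rewrite (freeZ_sum c) raddf_sum; apply: supported_sum => t _.
rewrite raddfMz; have [Pt|/Pc ->] := boolP (P t).
  by apply: supportedMz; apply: h.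
exact: supported0.
Qed.

Lemma supported_eq T (V : zmodType) (P : pred T) (f g : {additive freeZ T -> V}) :
  (forall t, P t -> f (gen t) = g (gen t)) ->
  forall c, supported P c -> f c = g c.
Proof.
move=> h c Pc; rewrite (freeZ_sum c) !raddf_sum; apply: eq_bigr => t _.
rewrite !raddfMz; have [/h -> //|/Pc ->] := boolP (P t).
by rewrite !mulr0z.
Qed.

Lemma freeZ_ext T (V : zmodType) (f g : {additive freeZ T -> V}) :
  (forall t, f (gen t) = g (gen t)) -> f =1 g.
Proof. by move=> h c; apply: (@supported_eq T V predT). Qed.

Lemma supported_mono (T : finType) (P Q : pred T) c :
  (forall t, P t -> Q t) -> supported P c -> supported Q c.
Proof. by move=> PQ h t Qt; apply: h; apply: contraNN Qt => /PQ. Qed.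

Lemma supported_split T (P Q R : pred T) (c : freeZ T) :
  (forall t, R t -> P t || Q t) -> supported R c ->
  exists a b, [/\ supported P a, supported Q b & c = a + b].
Proof.
move=> h Rc; exists [ffun t => if P t then c t else 0].
exists [ffun t => if P t then 0 else c t]; split.
- by move=> t Pt; rewrite ffunE (negPf Pt).
- move=> t Qt; rewrite ffunE; case: ifPn => // Pt; apply: Rc.
  by apply/negP => /h; rewrite (negPf Pt) (negPf Qt).
by apply/ffunP => t; rewrite !ffunE; case: ifP; rewrite ?addr0 ?add0r.
Qed.

Lemma sum_gen_inj T U (h : T -> U) (B : pred T) (a : T -> int) t0 :
  injective h -> (\sum_(t | B t) gen (h t) *~ a t) (h t0) = if B t0 then a t0 else 0.
Proof.
move=> hI; rewrite sum_ffunE big_mkcond (bigD1 t0) //= big1.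
  by rewrite addr0; case: ifP => // _; rewrite ffunMzE ffunE eqxx intz.
move=> t /negPf tt0; case: ifP => // _.
by rewrite ffunMzE ffunE (inj_eq hI) eq_sym tt0 mul0rz.
Qed.

End Support.

(** * Simplices of the nerve and flags *)

Section Simplices.
Variables (d : Order.disp_t) (X : finPOrderType d).

Lemma nerve_le r (s : nerve X r) (j k : 'I_r.+1) :
  (j <= k)%N -> (val s k <= val s j)%O.
Proof.
by move=> jk; move: (valP s) => /forallP/(_ j)/forallP/(_ k)/implyP; apply.
Qed.

Lemma nerve_ext r (s t : nerve X r) : (forall k, val s k = val t k) -> s = t.
Proof. by move=> h; apply/val_inj/ffunP. Qed.

Lemma nerve_faceE r (j : 'I_r.+2) (s : nerve X r.+1) k :
  val (nerve_face j s) k = val s (lift j k).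
Proof. by rewrite ffunE. Qed.

Fact nerve_cons_subproof x r (s : nerve X r) : (val s ord0 <= x)%O ->
  decreasing [ffun k => if unlift ord0 k is Some k' then val s k' else x].
Proof.
move=> sx; apply/forallP => j; apply/forallP => k; apply/implyP; rewrite !ffunE.
case: unliftP => [k' ->|->]; case: unliftP => [j' ->|->] //=.
  by rewrite leq_bump2 => /(nerve_le s).
by move=> _; apply: le_trans sx; apply: nerve_le.
Qed.
Definition nerve_cons x r (s : nerve X r) (sx : (val s ord0 <= x)%O) :
  nerve X r.+1 := exist (@decreasing _ X r.+1) _ (nerve_cons_subproof sx).

Lemma nerve_cons0 x r (s : nerve X r) (sx : (val s ord0 <= x)%O) :
  val (nerve_cons sx) ord0 = x.
Proof. by rewrite ffunE unlift_none. Qed.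

Lemma nerve_consS x r (s : nerve X r) (sx : (val s ord0 <= x)%O) k :
  val (nerve_cons sx) (lift ord0 k) = val s k.
Proof. by rewrite ffunE liftK. Qed.

Lemma nerve_face0_cons x r (s : nerve X r) (sx : (val s ord0 <= x)%O) :
  nerve_face ord0 (nerve_cons sx) = s.
Proof. by apply: nerve_ext => k; rewrite nerve_faceE nerve_consS. Qed.

Lemma nerve_cons_face0 x r (s : nerve X r.+1)
    (sx : (val (nerve_face ord0 s) ord0 <= x)%O) :
  val s ord0 = x -> nerve_cons sx = s.
Proof.
move=> s0; apply: nerve_ext => k; case: (unliftP ord0 k) => [k' ->|->].
  by rewrite nerve_consS nerve_faceE.
by rewrite nerve_cons0 s0.
Qed.

End Simplices.

Section FlagSimplices.
Variables (d : Order.disp_t) (X : cccType d).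

Lemma simplex_setP r (s : nerve X r) y :
  reflect (exists k, y = val s k) (y \in simplex_set s).
Proof. by apply: (iffP imsetP) => [[k _ ->]|[k ->]]; exists k. Qed.

Lemma mem_simplex r (s : nerve X r) k : val s k \in simplex_set s.
Proof. by apply/simplex_setP; exists k. Qed.

(** An onto map from a finite set to an equipotent one is injective, so [v] is
    strictly decreasing; counting from either end then forces its values. *)
Lemma antitone_onto r (v : 'I_r.+1 -> nat) :
  (forall j k : 'I_r.+1, (j <= k)%N -> (v k <= v j)%N) ->
  (forall m, (m <= r)%N -> exists k, v k = m) ->
  (forall k, (v k <= r)%N) ->
  forall k, v k = (r - k)%N.
Proof.
move=> mono onto bound.
have [u hu] : exists u : 'I_r.+1 -> 'I_r.+1, forall m, v (u m) = m.
  by apply: (@fin_all_exists _ _ (fun m k => v k = nat_of_ord m)) => m;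
    apply: onto; rewrite -ltnS.
have uI : injective u by move=> m n e; apply: val_inj; rewrite /= -!hu e.
have [w uK wK] := injF_bij uI.
have vI : injective v.
  by move=> j k; rewrite -(wK j) -(wK k) !hu => /val_inj ->.
have step (j k : 'I_r.+1) : (j < k)%N -> (v k < v j)%N.
  move=> jk; rewrite ltn_neqAle mono 1?ltnW // andbT.
  by apply: contraTneq jk => /vI ->; rewrite ltnn.
have up n : forall k : 'I_r.+1, k = n :> nat -> (v k + n <= r)%N.
  elim: n => [|n IH] k e; first by rewrite addn0.
  have hn : (n < r.+1)%N by have := ltn_ord k; lia.
  have := IH (Ordinal hn) erefl; have := @step (Ordinal hn) k; rewrite /= e.
  by move/(_ (ltnSn n)); lia.
have down n : forall k : 'I_r.+1, (r - k)%N = n -> (n <= v k)%N.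
  elim: n => [|n IH] k e //.
  have hn : (k.+1 < r.+1)%N by lia.
  have := IH (Ordinal hn); have := @step k (Ordinal hn) (ltnSn _); rewrite /=.
  by move=> h1 h2; have := h2 ltac:(lia); lia.
by move=> k; have := up _ k erefl; have := down _ k erefl; have := ltn_ord k; lia.
Qed.

(** Flags are sets of cells, simplices are sequences: the simplices whose
    underlying set is a flag are those that start at the top cell and go down
    by one rank at each step. *)
Lemma simplex_flagP r (x : X) (s : nerve X r) : rk x = r -> reflect
  (val s ord0 = x /\ forall k : 'I_r.+1, rk (val s k) = (r - k)%N)
  (simplex_set s \in flags (cl x)).
Proof.
move=> rx; apply: (iffP idP) => [hF|[s0 hs]].
  have /flagP [h1 h2 h3] := hF.
  have hr : forall k : 'I_r.+1, rk (val s k) = (r - k)%N.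
    apply: antitone_onto => [j k /(nerve_le s)/rk_le //|m|k].
      move=> mr; have [|y /simplex_setP [k ->] e] := h3 m; first by rewrite rx.
      by exists k.
    by rewrite -[leqRHS]rx; apply/rk_le/h1/mem_simplex.
  split=> //; have /simplex_setP [k e] := flag_top hF.
  have := hr k; rewrite -e rx => hk; rewrite e; congr (val s _).
  by apply: val_inj => /=; have := ltn_ord k; lia.
apply/flagP; split.
- by move=> y /simplex_setP [k ->]; rewrite -s0 nerve_le.
- move=> y z /simplex_setP [k ->] /simplex_setP [l ->].
  by apply/orP; case: (leqP k l) => [|/ltnW] /(nerve_le s) ->; [right|left].
move=> m; rewrite rx => mr; exists (val s (inord (r - m))); first exact: mem_simplex.
by rewrite hs inordK; lia.
Qed.

Lemma simplex_set_cons x r (s : nerve X r) (sx : (val s ord0 <= x)%O) :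
  simplex_set (nerve_cons sx) = x |: simplex_set s.
Proof.
apply/setP => y; rewrite in_setU1; apply/simplex_setP/orP.
  case=> k ->; case: (unliftP ord0 k) => [k' ->|->].
    by right; rewrite nerve_consS mem_simplex.
  by left; rewrite nerve_cons0.
case=> [/eqP ->|/simplex_setP [k ->]]; first by exists ord0; rewrite nerve_cons0.
by exists (lift ord0 k); rewrite nerve_consS.
Qed.

End FlagSimplices.

(** * The comparison map commutes with boundaries *)

Section ChainMap.
Variables (d : Order.disp_t) (X : cccType d) (om : oriented_cells X).

(** Deleting the top cell of a flag of [x] leaves a flag of a face of [x], and
    both sides have at most one nonzero term, namely [x :: t] on the left and the
    top cell of [t] on the right.  They agree by the definition of incidence. *)
Lemma flag_face0_sum i (x : X) (t : nerve X i) : rk x = i.+1 ->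
  \sum_(s : nerve X i.+1 | (simplex_set s \in flags (cl x)) &&
                           (nerve_face ord0 s == t)) om x (simplex_set s) =
  \sum_(f : cells [set: X] i | (val f \in faces x) &&
                    (simplex_set t \in flags (cl (val f))))
    incidence om x (val f) * om (val f) (simplex_set t).
Proof.
move=> rx.
have flag_head (f : cells [set: X] i) :
    simplex_set t \in flags (cl (val f)) -> val f = val t ord0.
  have /andP [_ /eqP rf] := valP f.
  by move/(simplex_flagP _ rf) => [].
case: (boolP ((val t ord0 \in faces x) &&
              (simplex_set t \in flags (cl (val t ord0))))) => [|nb].
  move=> /andP [tx tf]; have /facesP [ltx rt] := tx.
  have ht : (val t ord0 \in [set: X]) && (rk (val t ord0) == i).
    by rewrite inE; apply/eqP; lia.
  rewrite (big_pred1 (nerve_cons (ltW ltx))) => [|s]; last first.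
    rewrite [RHS]/=; apply/andP/eqP => [[hs /eqP et]|->].
      have [s0 _] := simplex_flagP s rx hs; subst t.
      by rewrite nerve_cons_face0.
    by rewrite nerve_face0_cons simplex_set_cons (flag_cons tx tf).
  rewrite (big_pred1 (exist _ (val t ord0) ht : cells [set: X] i)) => [|f]; last first.
    rewrite [RHS]/= -val_eqE /=; apply/andP/eqP => [[_ /flag_head //]|->].
    by rewrite tx tf.
  rewrite /= simplex_set_cons (incidence_cons _ tx tf).
  by case: (orient_sign om tf) => ->;
    rewrite ?invr1 ?invrN1 ?divr1 ?mulr1 ?mulrN1 ?mulrNN ?mulr1 ?opprK.
rewrite !big_pred0 // => [f|s]; apply: contraNF nb => /andP [].
  by move=> fx hf; rewrite -(flag_head _ hf) fx hf.
move=> /(simplex_flagP s rx) [s0 hs] /eqP <-.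
have r0 : rk (val (nerve_face ord0 s) ord0) = i.
  by rewrite nerve_faceE hs /= /bump /=; lia.
apply/andP; split.
  apply/facesP; rewrite r0; split=> //.
  rewrite lt_neqAle nerve_faceE -[X in (_ <= X)%O]s0 nerve_le // andbT.
  by apply: contra_eqN rx => /eqP <-; rewrite hs /= /bump /=; lia.
apply/simplex_flagP => //; split=> // k.
by rewrite nerve_faceE hs /= /bump /=; lia.
Qed.

(** The cells that may replace the [j]-th entry of the flag [s], for [j > 0]:
    those lying between the two neighbouring entries, or just below the last
    edge when [j] is the final index. *)
Definition flag_slot i (s : nerve X i.+1) (j : 'I_i.+2) : {set X} :=
  [set u | (u \in faces (val s (inord j.-1))) &&
           ((j < i.+1)%N ==> (val s (inord j.+1) \in faces u))].

Lemma flag_slotP i (x : X) (s : nerve X i.+1) (j : 'I_i.+2) :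
  rk x = i.+1 -> simplex_set s \in flags (cl x) -> j != ord0 ->
  val s j \in flag_slot s j.
Proof.
move=> rx /(simplex_flagP s rx) [s0 hs] j0.
have jp : (0 < j)%N by rewrite lt0n.
have jl := ltn_ord j.
have face (a b : 'I_i.+2) : b = a.+1 :> nat -> val s b \in faces (val s a).
  move=> e; have al := ltn_ord a; have bl := ltn_ord b.
  apply/facesP; rewrite !hs; split; last lia.
  rewrite lt_neqAle nerve_le ?e // andbT.
  by apply: contraTneq isT => /(congr1 (@rk _ X)); rewrite !hs; lia.
rewrite inE; apply/andP; split; first by apply: face; rewrite inordK; lia.
by apply/implyP => h; apply: face; rewrite inordK.
Qed.

(** The diamond axiom when the slot is interior; when it is the last one, the
    slot is the set of vertices of an edge, and it has two elements because [X]
    is non-singular. *)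
Lemma card_flag_slot i (x : X) (s : nerve X i.+1) (j : 'I_i.+2) :
  non_singular [set: X] -> rk x = i.+1 -> simplex_set s \in flags (cl x) ->
  j != ord0 -> #|flag_slot s j| = 2%N.
Proof.
move=> [_ _ edges] rx sF j0; have hj := flag_slotP rx sF j0.
have [s0 hs] := simplex_flagP s rx sF.
have jp : (0 < j)%N by rewrite lt0n.
have jl := ltn_ord j.
have jm : (j.-1 < i.+2)%N by lia.
have := hj; rewrite /flag_slot inE; case: (ltnP j i.+1) => [ji|ij] /=.
  move=> /andP [/facesP [lt1 r1] /facesP [lt2 r2]].
  have [|yp [ym [ne E _]]] := diamond (lt_trans lt2 lt1); first by rewrite r1 r2.
  transitivity #|[set yp; ym]|; last by rewrite cards2 ne.
  rewrite -E; apply: eq_card => u; rewrite !inE.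
  by [].
move=> _; rewrite -(edges (val s (inord j.-1))) ?inE ?hs ?inordK //; last by lia.
by apply: eq_card => u; rewrite !inE andbT.
Qed.

Lemma card_simplex_diff i (x : X) (s t : nerve X i.+1) (j : 'I_i.+2) :
  rk x = i.+1 -> simplex_set s \in flags (cl x) ->
  simplex_set t \in flags (cl x) ->
  (forall k, k != j -> val s k = val t k) -> val s j != val t j ->
  #|simplex_set s :\: simplex_set t| == 1%N.
Proof.
move=> rx /(simplex_flagP s rx) [_ hs] /(simplex_flagP t rx) [_ ht] e ne.
apply/cards1P; exists (val s j); apply/setP => y; rewrite !inE.
apply/andP/eqP => [[yt /simplex_setP [k ys]]|->].
  rewrite ys; case: (eqVneq k j) => [-> //|kj]; case/negP: yt.
  by rewrite ys e // mem_simplex.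
rewrite mem_simplex; split=> //; apply/negP => /simplex_setP [k ek].
have : rk (val s j) = rk (val t k) by rewrite ek.
rewrite hs ht => h; have kj : k = j.
  by apply: val_inj => /=; have := ltn_ord k; have := ltn_ord j; lia.
by move: ne; rewrite ek kj eqxx.
Qed.

Lemma nerve_face_inj i (j k : 'I_i.+2) (s t : nerve X i.+1) :
  nerve_face j s = nerve_face j t -> k != j -> val s k = val t k.
Proof.
move=> e; case: (unliftP j k) => [k' -> _|->]; last by rewrite eqxx.
by rewrite -!nerve_faceE e.
Qed.

Lemma replace_entry i (x : X) (s : nerve X i.+1) (j : 'I_i.+2) u :
  rk x = i.+1 -> simplex_set s \in flags (cl x) -> j != ord0 ->
  u \in flag_slot s j ->
  exists t : nerve X i.+1, [/\ val t j = u, nerve_face j t = nerve_face j s &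
    simplex_set t \in flags (cl x)].
Proof.
move=> rx /(simplex_flagP s rx) [s0 hs] j0.
have jp : (0 < j)%N by rewrite lt0n.
have jl := ltn_ord j.
have jm : (j.-1 < i.+2)%N by lia.
rewrite inE => /andP [/facesP [us ru] /implyP us'].
have below (k : 'I_i.+2) : (k < j)%N -> (u <= val s k)%O.
  move=> kj; apply: le_trans (ltW us) _; apply: nerve_le.
  by rewrite inordK //; lia.
have above (k : 'I_i.+2) : (j < k)%N -> (val s k <= u)%O.
  move=> jk; have kl := ltn_ord k; have ji : (j < i.+1)%N by lia.
  have /facesP [lt _] := us' ji; apply: le_trans (ltW lt).
  by apply: nerve_le; rewrite inordK.
pose t : {ffun 'I_i.+2 -> X} := [ffun k => if k == j then u else val s k].
have dt : decreasing t.
  apply/forallP => a; apply/forallP => b; apply/implyP => ab; rewrite !ffunE.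
  case: (eqVneq b j) => [bj|bj]; case: (eqVneq a j) => [aj|aj] //.
  - by apply: below; rewrite ltn_neqAle aj -bj.
  - by apply: above; rewrite ltn_neqAle eq_sym bj -aj.
  exact: nerve_le.
exists (exist _ t dt); split; first by rewrite ffunE eqxx.
  apply: nerve_ext => k; rewrite !nerve_faceE ffunE.
  by rewrite eq_sym (negPf (neq_lift _ _)).
apply/(simplex_flagP _ rx); split=> [|k]; rewrite ffunE.
  by rewrite eq_sym (negPf j0).
case: eqP => [->|_ //]; move: ru; rewrite hs inordK //; lia.
Qed.

(** The flags of [x] that become [t] after deletion of the [j]-th entry, if there
    are any, are exactly two adjacent flags, on which the orientation takes
    opposite values. *)
Lemma flag_face_sum0 i (x : X) (t : nerve X i) (j : 'I_i.+2) :
  non_singular [set: X] -> rk x = i.+1 -> j != ord0 ->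
  \sum_(s : nerve X i.+1 | (simplex_set s \in flags (cl x)) &&
                           (nerve_face j s == t)) om x (simplex_set s) = 0.
Proof.
move=> ns rx j0.
case: (pickP (fun s : nerve X i.+1 => (simplex_set s \in flags (cl x)) &&
  (nerve_face j s == t))) => [s /andP [sF /eqP st]|]; last exact: big_pred0.
have sj := flag_slotP rx sF j0.
have : #|flag_slot s j :\ val s j| == 1%N.
  by have := cardsD1 (val s j) (flag_slot s j);
    rewrite (card_flag_slot ns rx sF j0) sj add1n => -[<-].
move=> /cards1P [u /setP hu].
have /setD1P [us hus] : u \in flag_slot s j :\ val s j by rewrite hu set11.
have [s' [s'j s's s'F]] := replace_entry rx sF j0 hus.
have ne : s' != s by apply: contraNneq us => e; rewrite -s'j e.
rewrite (bigD1 s) ?sF ?st ?eqxx //= (bigD1 s') ?s'F ?s's ?st ?eqxx ?ne //=.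
rewrite big1 => [|s2]; last first.
  move=> /andP [/andP [/andP [s2F /eqP s2t] n1] n2].
  have e k : k != j -> val s2 k = val s k.
    by apply: nerve_face_inj; rewrite s2t st.
  have e' k : k != j -> val s' k = val s k by apply: nerve_face_inj.
  have : val s2 j \in flag_slot s j.
    have jl := ltn_ord j; have jp : (0 < j)%N by rewrite lt0n.
    have := flag_slotP rx s2F j0; rewrite !inE (e (inord j.-1)); last first.
      by rewrite -val_eqE /= inordK; lia.
    case: (ltnP j i.+1) => //= ji; rewrite (e (inord j.+1)) //.
    by rewrite -val_eqE /= inordK //; lia.
  have := hu (val s2 j); rewrite in_setD1 => h h2; move: h; rewrite h2 andbT in_set1.
  case: (eqVneq (val s2 j) (val s j)) => [e2|_] /= h.
    case/eqP: n1; apply: nerve_ext => k.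
    by case: (eqVneq k j) => [-> //|/e].
  case/eqP: n2; apply: nerve_ext => k.
  case: (eqVneq k j) => [->|kj]; last by rewrite e // e'.
  by rewrite s'j; apply/eqP; rewrite -h.
have e k : k != j -> val s k = val s' k by apply: nerve_face_inj.
have dj : val s j != val s' j by rewrite s'j eq_sym.
rewrite addr0 ((orientationP om x).2 _ (simplex_set s')) ?addNr //.
apply/and4P; split=> //; first exact: card_simplex_diff rx sF s'F e dj.
apply: (card_simplex_diff rx s'F sF (j := j)); last by rewrite eq_sym.
by move=> k kj; rewrite e.
Qed.

(** Compare the coefficients of a simplex [t].  In the nerve boundary of
    [Phi [x]], the face deleting the top cell accounts for [Phi (bd [x])], and the
    other faces contribute zero. *)
Lemma Phi_chain_map : non_singular [set: X] -> is_chain_map (Phi om).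
Proof.
move=> ns i c; move: c.
apply: (@freeZ_ext _ _ (Phi om i \o bd (cellular_full om) i)
  (bd (nerve_complex X) i \o Phi om i.+1)) => x.
have /andP [_ /eqP rx] := valP x; rewrite /= -!/(lin_ext _) !lin_ext_gen.
apply/ffunP => t; rewrite !raddf_sum !sum_ffunE.
transitivity (\sum_(f : cells [set: X] i | (val f \in faces (val x)) &&
      (simplex_set t \in flags (cl (val f))))
    incidence om (val x) (val f) * om (val f) (simplex_set t)).
  rewrite [RHS]big_mkcondr; apply: eq_bigr => f _.
  rewrite raddfMz /= -/(lin_ext _) lin_ext_gen ffunMzE.
  rewrite (@sum_gen_inj _ _ id) //.
  by case: ifP => _; rewrite ?mul0rz // -mulrzr intz mulrC.
rewrite -flag_face0_sum //.
transitivity (\sum_(s : nerve X i.+1 | simplex_set s \in flags (cl (val x)))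
   \sum_(j < i.+2) (if nerve_face j s == t then
        om (val x) (simplex_set s) * (-1) ^+ j else 0)).
  rewrite exchange_big big_ord_recl /= [X in _ = _ + X]big1 => [|j _].
    rewrite addr0 [LHS]big_mkcondr; apply: eq_bigr => s _.
    by rewrite expr0 mulr1.
  rewrite -big_mkcondr -mulr_suml flag_face_sum0 ?mul0r //.
apply: eq_bigr => s _; rewrite raddfMz /= -/(lin_ext _) lin_ext_gen ffunMzE.
rewrite sum_ffunE mulrz_suml; apply: eq_bigr => j _.
rewrite !ffunMzE ffunE eq_sym; case: eqP => _; last by rewrite !mul0rz.
by rewrite !mulrzz mul1r mulrC.
Qed.

End ChainMap.

(** * Acyclic cells and change of orientation *)

Section Augmentation.

Definition aug (T : finType) : {additive freeZ T -> int} := lin_ext (fun=> 1).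

Lemma aug_gen (T : finType) (t : T) : aug T (gen t) = 1.
Proof. exact: lin_ext_gen. Qed.

(** Homology isomorphic to [int] has rank one, so the classes of [c] and of [v]
    satisfy a relation [m [c] = n [v]], where [m] and [n] are their images in
    [int].  Applying [a] gives [n * a v = 0], so [n = 0] and [c] is a boundary.
    Thus an abstract isomorphism is as good as the augmentation. *)
Lemma acyclic0_boundary (K : chain_complex) (a : {additive K 0 -> int}) (v : K 0) :
  (exists f : {additive homology K 0 -> int}, bijective f) ->
  (forall y, a (bd K 0 y) = 0) -> a v != 0 ->
  forall c, a c = 0 -> exists y, bd K 0 y = c.
Proof.
move=> [f /bij_inj fI] abd av c ac.
pose cls (u : K 0) := (\pi_(homology K 0) (exist _ u isT : cycles K 0))%qT.
have clsE (u : K 0) : f (cls u) = 0 -> exists y, bd K 0 y = u.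
  move=> fu; have : cls u = 0 by apply: fI; rewrite fu raddf0.
  by move/eqP; rewrite /cls pi_eq0 => /asboolP.
pose m := f (cls v); pose n := f (cls c).
have clsMB : cls (c *~ m - v *~ n) = cls c *~ m - cls v *~ n.
  rewrite /cls -!raddfMz -raddfB; congr (\pi_(homology K 0) _)%qT.
  have valMz (w : cycles K 0) k : val (w *~ k) = val w *~ k by exact: raddfMz.
  by apply: val_inj; rewrite raddfB /= !valMz.
have [|y hy] := clsE (c *~ m - v *~ n).
  rewrite clsMB raddfB /= !(raddfMz f) -/m -/n !mulrzz.
  by rewrite mulrC subrr.
apply: clsE; have := abd y; rewrite hy raddfB /= !(raddfMz a) ac mul0rz sub0r mulrzz.
by move/eqP; rewrite oppr_eq0 mulf_eq0 (negPf av) /= => /eqP.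
Qed.

End Augmentation.

Section ChangeOrientation.
Variables (d : Order.disp_t) (X : cccType d) (om om' : oriented_cells X).

(** The sign by which the two orientations of [y] differ. *)
Definition orient_ratio (y : X) : int :=
  if [pick F in flags (cl y)] is Some F then om' y F * om y F else 1.

(** Both orientations change sign along an edge of the flag graph, which is
    connected. *)
Lemma orient_ratioE y F : F \in flags (cl y) ->
  om' y F = orient_ratio y * om y F.
Proof.
rewrite /orient_ratio; case: pickP => [F0 h0|/(_ F) -> //] hF.
have /connectP [p] := (oriented_orientable om y).1 _ _ h0 hF.
elim: p F0 h0 => [|G p IH] F0 h0 /=.
  by move=> _ ->; case: (orient_sign om h0) => ->; rewrite -?mulrA ?mulrNN ?mulr1.
move=> /andP [aG hp] e; have hG : G \in flags (cl y) by case/and4P: aG.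
rewrite (IH _ hG hp e) ((orientationP om y).2 _ _ aG).
by rewrite ((orientationP om' y).2 _ _ aG) mulrNN.
Qed.

Lemma orient_ratio_sqr y : orient_ratio y * orient_ratio y = 1.
Proof.
rewrite /orient_ratio; case: pickP => [F hF|//].
by case: (orient_sign om hF) => ->; case: (orient_sign om' hF) => ->.
Qed.

Lemma incidence_ratio y z : y \in faces z ->
  orient_ratio y * incidence om' z y = incidence om z y * orient_ratio z.
Proof.
move=> yz; have [G hG] := flag_exists y.
rewrite !(incidence_cons _ yz hG) !orient_ratioE ?(flag_cons yz) //.
have : orient_ratio y == 1 \/ orient_ratio y == -1.
  by apply/orP; rewrite -sqrf_eq1 expr2 orient_ratio_sqr.
by case=> /eqP ->; case: (orient_sign om hG) => ->;
  rewrite ?mulrNN ?mulr1 ?mul1r ?mulN1r ?opprK ?invrN1 ?invr1; ring.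
Qed.

Variable x : X.

Fact cell_incl_subproof r (f : cells (cl x) r) :
  (val f \in [set: X]) && (rk (val f) == r).
Proof. by have /andP [_ ->] := valP f; rewrite inE. Qed.
Definition cell_incl r (f : cells (cl x) r) : cells [set: X] r :=
  exist _ (val f) (cell_incl_subproof f).

Lemma cell_incl_inj r : injective (@cell_incl r).
Proof. by move=> f g /(congr1 val) e; apply: val_inj. Qed.

Lemma cell_inclP r (z : cells [set: X] r) : val z \in cl x ->
  exists f, z = cell_incl f.
Proof.
move=> zx; have hz : (val z \in cl x) && (rk (val z) == r).
  by rewrite zx; have /andP [] := valP z.
by exists (exist _ (val z) hz); apply: val_inj.
Qed.

(** The inclusion of the cells of [cl x], rescaled by the orientation ratio so
    as to be a chain map from the complex oriented by [om'] to the one oriented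
    by [om].  It carries acyclicity of [cl x], which is known for some
    orientation only, to the given orientation. *)
Definition cell_emb r :
    {additive freeZ (cells (cl x) r) -> freeZ (cells [set: X] r)} :=
  lin_ext (fun f => gen (cell_incl f) *~ orient_ratio (val f)).

Lemma cell_emb_incl r c (f : cells (cl x) r) :
  cell_emb r c (cell_incl f) = orient_ratio (val f) * c f.
Proof.
rewrite /= /lin_ext_fun; under eq_bigr => t _ do rewrite -mulrzA.
by rewrite sum_gen_inj //; apply: cell_incl_inj.
Qed.

Lemma cell_emb_supported r c :
  supported (fun f => val f \in cl x) (cell_emb r c).
Proof.
apply: supported_sum => f _; do 2!apply: supportedMz; apply: supported_gen.
by have /andP [] := valP f.
Qed.

Lemma cell_emb_inj r : injective (cell_emb r).
Proof.
apply: raddf_inj => c e; apply/ffunP => f; rewrite ffunE.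
have := cell_emb_incl c f; rewrite e ffunE => /esym.
move/(congr1 ( *%R (orient_ratio (val f)))).
by rewrite mulrA orient_ratio_sqr mul1r mulr0.
Qed.

Lemma cell_emb_onto r c : supported (fun f => val f \in cl x) c ->
  exists c', cell_emb r c' = c.
Proof.
move=> hc; exists [ffun f => orient_ratio (val f) * c (cell_incl f)].
apply/ffunP => z; have [zx|zx] := boolP (val z \in cl x); last first.
  by rewrite hc // cell_emb_supported.
have [f ->] := cell_inclP zx.
by rewrite cell_emb_incl ffunE mulrA orient_ratio_sqr mul1r.
Qed.

Lemma cell_emb_bd r c :
  cell_emb r (bd (cellular om' (@cl_down _ X x)) r c) =
  bd (cellular_full om) r (cell_emb r.+1 c).
Proof.
move: c; apply: (@freeZ_ext _ _
  (cell_emb r \o bd (cellular om' (@cl_down _ X x)) r)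
  (bd (cellular_full om) r \o cell_emb r.+1)) => y.
rewrite /= -!/(lin_ext _) !lin_ext_gen raddfMz /= -!/(lin_ext _) lin_ext_gen.
apply/ffunP => z; rewrite ffunMzE (@sum_gen_inj _ _ id) //.
have [zx|zx] := boolP (val z \in cl x).
  have [f ->] := cell_inclP zx; rewrite raddf_sum.
  under eq_bigr => t _ do
    rewrite raddfMz /= -/(lin_ext _) lin_ext_gen -mulrzA.
  rewrite sum_gen_inj; last exact: cell_incl_inj.
  rewrite -[val (cell_incl f)]/(val f) -[val (cell_incl y)]/(val y).
  by case: ifP => h; rewrite ?mul0rz // incidence_ratio // -mulrzr intz.
rewrite cell_emb_supported // ifN ?mul0rz //.
apply: contra zx => /facesP [zy _]; rewrite inE.
by have /andP [] := valP y; rewrite inE => /(le_trans (ltW zy)).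
Qed.

End ChangeOrientation.

(** * The nerve below a cell is a cone *)

Section Contraction.
Variables (d : Order.disp_t) (X : finPOrderType d) (x : X).

Definition below_top r (s : nerve X r) : bool := (val s ord0 <= x)%O.

(** The simplex [x :: s], or 0 when this sequence is not decreasing. *)
Definition cone_gen r (s : nerve X r) : freeZ (nerve X r.+1) :=
  match idP : reflect (below_top s) (below_top s) with
  | ReflectT sx => gen (nerve_cons sx)
  | ReflectF _ => 0
  end.

Lemma cone_genE r (s : nerve X r) (sx : below_top s) :
  cone_gen s = gen (nerve_cons sx).
Proof.
rewrite /cone_gen; case: {-}_ / idP => [sx'|/(_ sx) //].
by rewrite (bool_irrelevance sx' sx).
Qed.

Definition contraction r : {additive freeZ (nerve X r) -> freeZ (nerve X r.+1)} :=
  lin_ext (@cone_gen r).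

Lemma below_face r (j : 'I_r.+2) (s : nerve X r.+1) :
  below_top s -> below_top (nerve_face j s).
Proof.
by move=> sx; rewrite /below_top nerve_faceE; apply: le_trans sx; apply: nerve_le.
Qed.

Lemma nerve_face_cons r (j : 'I_r.+2) (s : nerve X r.+1) (sx : below_top s) :
  nerve_face (lift ord0 j) (nerve_cons sx) = nerve_cons (below_face j sx).
Proof.
apply: nerve_ext => k; rewrite nerve_faceE; case: (unliftP ord0 k) => [k' ->|->].
  rewrite nerve_consS nerve_faceE -(nerve_consS sx); congr (val (nerve_cons sx) _).
  by apply: val_inj; rewrite /= /bump /= !add1n ltnS addnS.
rewrite nerve_cons0 -[RHS](nerve_cons0 sx); congr (val (nerve_cons sx) _).
exact: val_inj.
Qed.

(** The nerve of [cl x] is a cone with apex [x]: deleting the apex from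
    [x :: s] gives back [s], and the other faces of [x :: s] are the [x :: s'] for
    [s'] a face of [s], with the opposite sign. *)
Lemma contraction_bd r (n : freeZ (nerve X r.+1)) :
  supported (@below_top r.+1) n ->
  nerve_bd X r.+1 (contraction r.+1 n) + contraction r (nerve_bd X r n) = n.
Proof.
apply: (@supported_eq _ _ _
  ((nerve_bd X r.+1 \o contraction r.+1) \+ (contraction r \o nerve_bd X r)) idfun).
move=> s sx; rewrite /= -!/(lin_ext _) !lin_ext_gen (cone_genE sx) lin_ext_gen.
rewrite big_ord_recl nerve_face0_cons expr0 raddf_sum -addrA -big_split /=.
rewrite big1 ?addr0 // => j _; rewrite nerve_face_cons raddfMz.
rewrite /= -/(lin_ext _) lin_ext_gen (cone_genE (below_face j sx)).
by rewrite /bump /= exprS mulN1r mulrNz addNr.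
Qed.

(** In degree 0 the cone operator joins each vertex to the apex, so the identity
    is corrected by the augmentation times the apex. *)
Lemma contraction_bd0 (n : freeZ (nerve X 0)) :
  supported (@below_top 0) n -> aug _ n = 0 ->
  nerve_bd X 0 (contraction 0 n) = n.
Proof.
move=> hn an.
have dx : decreasing [ffun _ : 'I_1 => x].
  by apply/forallP => j; apply/forallP => k; rewrite !ffunE lexx implybT.
pose apex : nerve X 0 := exist (@decreasing _ X 0) _ dx.
suff {an} : forall n : freeZ (nerve X 0), supported (@below_top 0) n ->
    nerve_bd X 0 (contraction 0 n) + lin_ext (fun=> gen apex) n = n.
  move/(_ n hn); have -> : lin_ext (fun=> gen apex) n = 0; last by rewrite addr0.
  move: an; rewrite /= /lin_ext_fun -!mulrz_sumr => an.
  by move: an; rewrite -mulrzr mul1r intz => ->.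
apply: (@supported_eq _ _ _
  ((nerve_bd X 0 \o contraction 0) \+ lin_ext (fun=> gen apex)) idfun).
move=> s sx; rewrite /= -!/(lin_ext _) !lin_ext_gen (cone_genE sx) lin_ext_gen.
rewrite big_ord_recl nerve_face0_cons big_ord1 expr0 /= expr1 -addrA.
rewrite (_ : nerve_face _ _ = apex) ?addNr ?addr0 //.
apply: nerve_ext => k; rewrite nerve_faceE [RHS]ffunE -[RHS](nerve_cons0 sx).
by congr (val (nerve_cons sx) _); apply: val_inj; rewrite [k]ord1.
Qed.

Lemma contraction_supported r (n : freeZ (nerve X r)) :
  @supported (nerve X r.+1) (fun s => [forall k, (val s k <= x)%O])
    (contraction r n).
Proof.
have: supported predT n by [].
apply: supported_map => s _; rewrite /= -/(lin_ext _) lin_ext_gen.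
have [sx|sx] := boolP (below_top s); last first.
  rewrite /cone_gen; case: {-}_ / idP => [h|_]; last exact: supported0.
  by rewrite h in sx.
rewrite (cone_genE sx); apply: supported_gen; apply/forallP => k.
by rewrite -[leRHS](nerve_cons0 sx) nerve_le.
Qed.

Lemma aug_nerve_bd (n : freeZ (nerve X 1)) : aug _ (nerve_bd X 0 n) = 0.
Proof.
apply: (@additive_freeZ0 _ _ (aug _ \o nerve_bd X 0)) => s {n}.
rewrite /= -!/(lin_ext _) lin_ext_gen big_ord_recl big_ord1 raddfD !raddfMz.
by rewrite /= -!/(lin_ext _) !lin_ext_gen.
Qed.

End Contraction.

(** * The comparison map is a quasi-isomorphism *)

Section Comparison.
Variables (d : Order.disp_t) (X : cccType d) (om : oriented_cells X).
Hypothesis X_ns : non_singular [set: X].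
Implicit Types (A B : {set X}) (x : X).

Let PhiP : is_chain_map (Phi om) := @Phi_chain_map _ _ om X_ns.
Local Notation C := (cellular_full om).
Local Notation N := (nerve_complex X).

Definition cells_in A i : C i -> Prop :=
  @supported (cells [set: X] i) (fun f => val f \in A).

Definition chains_in A i : N i -> Prop :=
  @supported (nerve X i) (fun s => [forall k, val s k \in A]).

(** The mapping cone of [Phi] restricted to [A]. *)
Definition cone_in A i : mapping_cone PhiP i -> Prop :=
  match i return mapping_cone PhiP i -> Prop with
  | 0 => @chains_in A 0
  | j.+1 => fun p => cells_in A p.1 /\ chains_in A p.2
  end.

Lemma cells_in_bd A i (c : C i.+1) :
  down_closed A -> cells_in A c -> cells_in A (bd C i c).
Proof.
move=> dA; apply: supported_map => x xA; rewrite /= -/(lin_ext _) lin_ext_gen.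
apply: supported_sum => f /facesP [fx _]; apply/supportedMz/supported_gen.
exact: dA xA (ltW fx).
Qed.

Lemma chains_in_bd A i (n : N i.+1) : chains_in A n -> chains_in A (bd N i n).
Proof.
apply: supported_map => s /forallP sA; rewrite /= -/(lin_ext _) lin_ext_gen.
apply: supported_sum => j _; apply/supportedMz/supported_gen/forallP => k.
by rewrite nerve_faceE.
Qed.

Lemma Phi_in A i (c : C i) :
  down_closed A -> cells_in A c -> chains_in A (Phi om i c).
Proof.
move=> dA; apply: supported_map => x xA; rewrite /= -/(lin_ext _) lin_ext_gen.
apply: supported_sum => s /flagP [sx _ _]; apply/supportedMz/supported_gen.
by apply/forallP => k; apply: dA xA (sx _ _); apply: mem_simplex.
Qed.

Lemma cone_in_subcomplex A : down_closed A -> subcomplex (@cone_in A).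
Proof.
move=> dA; split=> [[|i]|[|i]|[|i]] /=.
- exact: supportedD.
- by move=> x y [x1 x2] [y1 y2]; split; apply: supportedD.
- exact: supportedN.
- by move=> x [x1 x2]; split; apply: supportedN.
- move=> x [x1 x2]; apply: supportedD; first exact: Phi_in.
  by apply/supportedN/chains_in_bd.
move=> x [x1 x2]; split; first exact: cells_in_bd.
apply: supportedD; first exact: Phi_in.
by apply/supportedN/chains_in_bd.
Qed.

(** [Phi] sends a vertex to itself, because vertices have orientation 1. *)
Lemma aug_Phi (c : C 0) : aug _ (Phi om 0 c) = aug _ c.
Proof.
move: c; apply: (@freeZ_ext _ _ (aug _ \o Phi om 0) (aug _)) => v.
have /andP [_ /eqP rv] := valP v.
have dv : decreasing [ffun _ : 'I_1 => val v].
  by apply/forallP => j; apply/forallP => k; rewrite !ffunE lexx implybT.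
pose s : nerve X 0 := exist (@decreasing _ X 0) _ dv.
have sE : simplex_set s = [set val v].
  apply/setP => y; rewrite in_set1; apply/simplex_setP/eqP.
    by case=> k ->; rewrite ffunE.
  by move=> ->; exists ord0; rewrite ffunE.
rewrite aug_gen /= -!/(lin_ext _) lin_ext_gen (big_pred1 s) => [|t].
  by rewrite raddfMz aug_gen sE orientation_vertex.
rewrite /=; apply/idP/eqP => [/(simplex_flagP t rv) [t0 _]|->].
  by apply: nerve_ext => k; rewrite [k]ord1 t0 ffunE.
apply/simplex_flagP => //; split=> [|k]; rewrite ffunE // rv.
Qed.

(** That the two vertices of an edge have opposite incidence need not be
    checked directly: it follows from the same fact in the nerve. *)
Lemma aug_cell_bd (c : C 1) : aug _ (bd C 0 c) = 0.
Proof. by rewrite -aug_Phi PhiP aug_nerve_bd. Qed.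

Lemma vertex_below x : exists v : cells [set: X] 0, val v \in cl x.
Proof.
have [F /flagP [Fx _ /(_ 0 (leq0n _)) [v vF rv]]] := flag_exists x.
have hv : (v \in [set: X]) && (rk v == 0%N) by rewrite inE rv.
by exists (exist _ v hv); rewrite inE Fx.
Qed.

(** Transport along [cell_emb] to the complex in which [cl x] is known to be
    acyclic.  In degree 0, the class of any vertex below [x] has nonzero
    augmentation. *)
Lemma acyclic_cell_exact x : acyclic (@cl_down _ X x) ->
  forall i (c : C i), cells_in (cl x) c -> is_cycle c ->
    (i = 0%N -> aug _ (c : freeZ (cells _ i)) = 0) ->
  exists2 c' : C i.+1, cells_in (cl x) c' & bd C i c' = c.
Proof.
move=> [om' [ac0 ac]] i c /(cell_emb_onto om om') [u <-] cyc augc.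
suff [u' <-] : exists u', bd (cellular om' (@cl_down _ X x)) i u' = u.
  by exists (cell_emb om om' x i.+1 u');
    [apply: cell_emb_supported | rewrite -cell_emb_bd].
case: i c u cyc augc => [|i] c u cyc augc.
  have [v vx] := vertex_below x; have [f vf] := cell_inclP vx.
  pose a := aug (cells [set: X] 0) \o cell_emb om om' x 0.
  apply: (@acyclic0_boundary (cellular om' (@cl_down _ X x)) a (gen f) ac).
  - by move=> y; rewrite /a /= cell_emb_bd aug_cell_bd.
  - rewrite /a /= -!/(lin_ext _) lin_ext_gen raddfMz aug_gen intz.
    apply/eqP => e; have := orient_ratio_sqr om om' (val f); rewrite e.
    by rewrite mul0r => /eqP; rewrite eq_sym oner_eq0.
  exact: augc.
have uc : is_cycle (u : cellular om' (@cl_down _ X x) i.+1).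
  apply/eqP/(@cell_emb_inj _ _ om om' x i); rewrite cell_emb_bd raddf0.
  exact/eqP.
exact: homology0_boundary (ac0 i.+1 isT) uc.
Qed.

(** In degree 0 the cycle condition is vanishing of the augmentation. *)
Lemma cl_contraction x i (n : N i) : chains_in (cl x) n ->
  (match i return N i -> Prop with
   | 0 => fun n => aug _ n = 0 | j.+1 => fun n => bd N j n = 0 end n) ->
  exists2 m : N i.+1, chains_in (cl x) m & bd N i m = n.
Proof.
move=> hn cyc; exists (contraction x i n).
  apply: supported_mono (contraction_supported (n : freeZ (nerve X i))).
  by move=> s /forallP h; apply/forallP => k; rewrite inE.
have {}hn : supported (@below_top _ X x i) (n : freeZ (nerve X i)).
  by apply: supported_mono hn => s /forallP /(_ ord0); rewrite inE.
case: i n hn cyc => [|i] n hn cyc; first exact: contraction_bd0.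
have := contraction_bd hn; rewrite (_ : nerve_bd X i n = 0) ?raddf0 ?addr0 //.
Qed.

(** Both complexes of [cl x] have the homology of a point, and [Phi] respects
    augmentations.  Given a cycle [(c, n)] of the cone, [c] bounds some [c'], and
    [Phi c' - n] is then a cycle of the nerve, hence bounds. *)
Lemma cl_exact x : acyclic (@cl_down _ X x) -> exact_on (@cone_in (cl x)).
Proof.
move=> ac [|i] z.
  move=> zx _; have [v vx] := vertex_below x.
  (* A 0-chain is homologous to the multiple of a vertex with the same
     augmentation. *)
  pose c : C 0 := gen v *~ aug _ z.
  have cx : cells_in (cl x) c by apply/supportedMz/supported_gen.
  have [||m mx hm] := @cl_contraction x 0 (Phi om 0 c - z).
  - by apply: supportedD; [apply: Phi_in => //; apply: cl_down | apply: supportedN].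
  - by rewrite raddfB /= aug_Phi /c raddfMz aug_gen intz subrr.
  exists ((c, m) : C 0 * N 1) => //=; rewrite hm opprB addrC subrK //.
case: z => c n [/= cx nx] zc.
have [cc cn] : is_cycle c /\ Phi om i c = bd N i n.
  case: i c n cx nx zc => [|i] c n cx nx.
    by rewrite /is_cycle /= subr_eq0 => /eqP.
  by rewrite /is_cycle /= => /eqP [-> /eqP]; rewrite subr_eq0 => /eqP.
have [|c' c'x hc'] := acyclic_cell_exact ac cx cc.
  by move=> i0; subst i; rewrite -aug_Phi cn aug_nerve_bd.
have [||m mx hm] := @cl_contraction x i.+1 (Phi om i.+1 c' - n).
- by apply: supportedD; [apply: Phi_in => //; apply: cl_down | apply: supportedN].
- by rewrite raddfB /= -PhiP hc' cn subrr.
exists ((c', m) : C i.+1 * N i.+2) => //=.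
by rewrite /cone_bd_fun /= hc' hm opprB addrC subrK.
Qed.

Lemma cone_in_setI A B i z :
  cone_in (A :&: B) z <-> @cone_in A i z /\ @cone_in B i z.
Proof.
have cE j (c : C j) : cells_in (A :&: B) c <-> cells_in A c /\ cells_in B c.
  split=> [h|[hA hB] f].
    by split; apply: supported_mono h => f; rewrite inE => /andP [].
  by rewrite inE negb_and => /orP [/hA|/hB].
have nE j (n : N j) : chains_in (A :&: B) n <-> chains_in A n /\ chains_in B n.
  split=> [h|[hA hB] s].
    by split; apply: supported_mono h => s /forallP h; apply/forallP => k;
      have := h k; rewrite inE => /andP [].
  have [sA|/hA //] := boolP [forall k, val s k \in A].
  have [sB|/hB //] := boolP [forall k, val s k \in B].
  by case/negP; apply/forallP => k; rewrite inE (forallP sA) (forallP sB).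
case: i z => [|i] z; first exact: nE.
rewrite /=; split=> [[/cE [? ?] /nE [? ?]] //|[[? ?] [? ?]]].
by split; [apply/cE | apply/nE].
Qed.

(** For simplices this uses that [A] and [B] are down-closed: a simplex lies in
    whichever of the two contains its first entry. *)
Lemma cone_in_setU A B : down_closed A -> down_closed B -> forall i z,
  cone_in (A :|: B) z <->
  exists a b, [/\ @cone_in A i a, @cone_in B i b & z = a + b].
Proof.
move=> dA dB.
have cE j (c : C j) : cells_in (A :|: B) c <->
    exists a b, [/\ cells_in A a, cells_in B b & c = a + b].
  split=> [|[a [b [ha hb ->]]]].
    by apply: supported_split => f; rewrite inE.
  by apply: supportedD; [move: ha|move: hb]; apply: supported_mono => f;
    rewrite inE => ->; rewrite ?orbT.
have nE j (n : N j) : chains_in (A :|: B) n <->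
    exists a b, [/\ chains_in A a, chains_in B b & n = a + b].
  split=> [|[a [b [ha hb ->]]]].
    apply: supported_split => s /forallP /(_ ord0); rewrite inE.
    by case/orP => s0; apply/orP; [left|right]; apply/forallP => k;
      [apply: dA s0 _|apply: dB s0 _]; apply: nerve_le.
  by apply: supportedD; [move: ha|move: hb]; apply: supported_mono => s /forallP h;
    apply/forallP => k; rewrite inE h ?orbT.
case=> [|i] z; first exact: nE.
rewrite /=; split=> [[/cE [a [b [ha hb e]]] /nE [a' [b' [ha' hb' e']]]]|].
  exists (a, a'), (b, b'); split=> //.
  by case: z e e' => ? ? /= -> ->.
move=> [a [b [[? ?] [? ?] ->]]].
by split; [apply/cE; exists a.1, b.1 | apply/nE; exists a.2, b.2].
Qed.

(** Remove a maximal cell [x] of [A]: then [A] is the union of [A :\ x] and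
    [cl x].  Both [A :\ x] and its intersection with [cl x] are down-closed and
    have fewer elements than [A], and [cl x] is covered by [cl_exact]. *)
Lemma cone_exact A : (forall x, acyclic (@cl_down _ X x)) ->
  down_closed A -> exact_on (@cone_in A).
Proof.
move=> ac; move: {2}#|A| (leqnn #|A|) => n; elim: n A => [|n IH] A An dA.
  move=> i z hz _; exists 0.
    case: i {z hz} => [|i]; rewrite /=; split; exact: supported0.
  move: An; rewrite leqn0 cards_eq0 raddf0 => /eqP A0; subst A.
  have c0 j (c : C j) : cells_in set0 c -> c = 0.
    by move=> h; apply/ffunP => f; rewrite h ?ffunE // inE.
  have n0 j (m : N j) : chains_in set0 m -> m = 0.
    move=> h; apply/ffunP => s; rewrite h ?ffunE //.
    by apply/negP => /forallP /(_ ord0); rewrite inE.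
  case: i z hz => [|i] /= z; first by move/n0.
  by case: z => c m [/= /c0 -> /n0 ->].
have [->|/set0Pn [x0 x0A]] := eqVneq A set0.
  by apply: IH; rewrite ?cards0 // => x y; rewrite inE.
have [x xA xmax] : exists2 x, x \in A & forall y, y \in A -> (rk y <= rk x)%N.
  by case: (arg_maxnP (@rk _ X) x0A) => x; exists x.
have clA : cl x \subset A by apply/subsetP => y; rewrite inE; apply: dA.
have dA' : down_closed (A :\ x).
  move=> y z /setD1P [yx yA] zy; apply/setD1P; split; last exact: dA yA zy.
  apply: contraNneq yx => zx; rewrite zx le_eqVlt in zy.
  by case/orP: zy => [/eqP -> //|/rk_lt]; rewrite ltnNge xmax.
have A'n : (#|A :\ x| <= n)%N by move: An; rewrite (cardsD1 x A) xA.
have AE : A = (A :\ x) :|: cl x.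
  apply/setP => y; rewrite !inE; case: (eqVneq y x) => [->|_] /=.
    by rewrite xA lexx.
  by apply/idP/orP => [|[//|]]; [left | apply: dA].
rewrite AE.
apply: (mayer_vietoris (cone_in_subcomplex dA') (cone_in_subcomplex (@cl_down _ X x))
  (cone_in_setI _ _) (cone_in_setU dA' (@cl_down _ X x))).
- exact: IH.
- exact/cl_exact/ac.
apply: IH.
  by apply: leq_trans A'n; apply/subset_leq_card/subsetIl.
by move=> y z /setIP [y1 y2] zy; apply/setIP;
  split; [apply: dA' zy | apply: cl_down zy].
Qed.

Lemma Phi_iso : (forall x, acyclic (@cl_down _ X x)) ->
  forall i, bijective (homology_map PhiP i).
Proof.
move=> ac; apply: cone_exact_iso => i z _ zc.
have [||w _ <-] := cone_exact ac (@setT_down _ X) (z := z) => //; last by exists w.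
have cT j (c : C j) : cells_in setT c by move=> f; rewrite inE.
have nT j (n : N j) : chains_in setT n.
  by move=> s; case/negP; apply/forallP => k; rewrite inE.
by case: i z {zc} => [|i] z; [apply: nT | split].
Qed.

End Comparison.

(** * Functoriality *)

Lemma nerve_homology_id (d : Order.disp_t) (X : finPOrderType d) i h :
  nerve_homology (idfun : {omorphism X -> X}) i h = h.
Proof.
rewrite -[h]reprK /= homology_map_pi;
  congr (\pi_(homology _ _) _)%qT.
apply: val_inj; case: (repr h) => c hc /=; move: c {hc}.
apply: (@freeZ_ext _ _ (nerve_chain_map idfun i) idfun) => s.
rewrite /= -/(lin_ext _) lin_ext_gen; congr gen.
by apply: nerve_ext => k; rewrite ffunE.
Qed.

Lemma nerve_homology_comp (d d' d'' : Order.disp_t) (X : finPOrderType d)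
    (Y : finPOrderType d') (Z : finPOrderType d'')
    (g : {omorphism Y -> Z}) (f : {omorphism X -> Y}) i h :
  nerve_homology (g \o f : {omorphism X -> Z}) i h =
  nerve_homology g i (nerve_homology f i h).
Proof.
rewrite -[h]reprK /= (homology_map_pi (nerve_chain_mapP f)) !homology_map_pi;
  congr (\pi_(homology _ _) _)%qT.
apply: val_inj; case: (repr h) => c hc /=; move: c {hc}.
apply: (@freeZ_ext _ _ (nerve_chain_map (g \o f) i)
  (nerve_chain_map g i \o nerve_chain_map f i)) => s.
rewrite /= -!/(lin_ext _) !lin_ext_gen; congr gen.
by apply: nerve_ext => k; rewrite !ffunE.
Qed.

Theorem mainTheorem3 :
  (forall (X : mccc) (om : oriented_cells X),
     exists hPhi : is_chain_map (Phi om),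
       forall i : nat, bijective (homology_map hPhi i)) /\
  (forall om : (forall X : mccc, oriented_cells X),
     exists (hPhi : forall X : mccc, is_chain_map (Phi (om X)))
            (hiso : forall (X : mccc) (i : nat),
                      bijective (homology_map (hPhi X) i)),
       forall i : nat,
         @is_functor mccc_category ab_category
           (fun X => homology (cellular_full (om X)) i)
           (fun (X Y : mccc) (f : {omorphism X -> Y}) =>
              (iso_inv (hiso Y i) \o nerve_homology f i
                 \o homology_map (hPhi X) i)%FUN)).
Proof.
have ns (X : mccc) : non_singular [set: X] by have [] := mccc_manifold X.
split=> [X om|om].
  by exists (Phi_chain_map (ns X)); apply/Phi_iso/mccc_acyclic.
exists (fun X => Phi_chain_map (ns X)).
exists (fun X => Phi_iso (om X) (ns X) (@mccc_acyclic X)) => i.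
split=> [X|X Y Z g f]; apply: additive_ext => h.
  by rewrite /= nerve_homology_id (proj1 (iso_invK _)).
by rewrite /= nerve_homology_comp (proj2 (iso_invK _)).
Qed.
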